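(* Let $R$ be a commutative ring. For all $r\ge1$ and $n\ge1$, the image of the natural homomorphism $\phi_n:\widetilde K^{\mathrm M}_n(R)\to K_n(R)$ from the modified Milnor $K$-group to the $n$-th $K$-group of $R$ is invariant under $\lambda^r$, i.e. $\lambda^r(\mathrm{im}\,\phi_n)\subseteq\mathrm{im}\,\phi_n$.
   Context: **Binary multicomplexes.** Let $R$ be a commutative ring and $\mathcal{P}(R)$ the exact category of finitely generated projective $R$-modules. For an exact category $\mathcal{E}$, an acyclic binary complex $(P_*,d,\tilde d)$ in $\mathcal{E}$ is a graded object $P_*$ in $\mathcal{E}$ supported on a finite subset of $[0,\infty)$ together with two degree $-1$ maps $d,\tilde d:P_*\to P_*$ such that both $(P_*,d)$ and $(P_*,\tilde d)$ are acyclic chain complexes. Morphisms are degree $0$ maps that are chain maps for both differentials; a sequence is short exact if it is so in each degree. This gives an exact category $B^{\mathrm q}_{\mathrm b}(\mathcal{E})$. Put $\mathcal{B}^0(R)=\mathcal{P}(R)$ and $\mathcal{B}^n(R)=B^{\mathrm q}_{\mathrm b}(\mathcal{B}^{n-1}(R))$. Explicitly, an object of $\mathcal{B}^n(R)$ is a $\mathbb{Z}_{\ge0}^n$-graded object with two acyclic differentials $d^i,\tilde d^i$ in each direction $1\le i\le n$, where differentials in different directions commute. It is called diagonal if $d^i=\tilde d^i$ for at least one $i$. **$K$-groups.** $K_n(R)$ is the quotient of the Grothendieck group $K_0(\mathcal{B}^n(R))$ obtained by declaring the classes of diagonal multicomplexes to be zero. (By Grayson, this is naturally isomorphic to Quillen's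 $K_n(R)$.) **Exterior power operations** (Harris–Köck–Taelman). Let $\Gamma$ and $N$ be the Dold–Kan functors between non-negatively graded chain complexes and simplicial objects: $\Gamma(C)_k=\bigoplus_{\eta:[k]\twoheadrightarrow[p]}C_p$, where for $\alpha:[l]\to[k]$ one factors $\eta\alpha=\varepsilon\eta'$ with $\eta'$ surjective and $\varepsilon:[q]\hookrightarrow[p]$ injective, and $\alpha^*$ maps the $\eta$-summand to the $\eta'$-summand by the identity if $\varepsilon=\mathrm{id}$, by the differential $d$ if $q=p-1$ and $\varepsilon$ misses only $0$, and by $0$ otherwise; $N(S)_k=\bigcap_{i=1}^k\ker(d_i)$ with differential $d_0$. If $F$ is a functor with $F(0)=0$, the graded object underlying $NF\Gamma(P_*,d)$ depends only on $P_*$ and not on $d$; so, for a binary complex, applying $NF\Gamma$ separately to $(P_*,d)$ and $(P_*,\tilde d)$ gives again a binary complex, denoted $NF\Gamma(P_*,d,\tilde d)$. Define $\Lambda^r_0=\Lambda^r$ (the usual $r$-th exterior power on $\mathcal{P}(R)$) and inductively $\Lambda^r_n=N\Lambda^r_{n-1}\Gamma:\mathcal{B}^n(R)\to\mathcal{B}^n(R)$, where $\Lambda^r_{n-1}$ is applied levelwise. It is known that $\Lambda^r_n$ does take values in $\mathcal{B}^n(R)$ and that, for $r,n\ge1$, there is a well-defined group homomorphism $\lambda^r:K_n(R)\to K_n(R)$ with $\lambda^r([\mathbb{P}])=[\Lambda^r_n(\mathbb{P})]$ for all $\mathbb{P}\in\mathcal{B}^n(R)$. **Modified Milnor $K$-groups**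 (Grech). $\mathrm{Aut}^n(\mathcal{P}(R))$ is the category of tuples $(P;A_1,\ldots,A_n)$ with $P\in\mathcal{P}(R)$ and pairwise commuting automorphisms $A_1,\ldots,A_n$ of $P$; morphisms are homomorphisms of the underlying modules compatible with the automorphisms. $\widetilde K^{\mathrm M}_n(R)$ is the abelian group generated by isomorphism classes of objects of $\mathrm{Aut}^n(\mathcal{P}(R))$ modulo: short-exact-sequence relations; multilinearity relations $(P;\ldots,A_iA_i',\ldots)=(P;\ldots,A_i,\ldots)+(P;\ldots,A_i',\ldots)$; and Steinberg relations $(P;A_1,\ldots,A_n)=0$ if $A_i+A_j=1$ for some $i\ne j$. **The map $\phi_n$.** To $(P;A_1,\ldots,A_n)$ one associates $[P;A_1,\ldots,A_n]\in\mathcal{B}^n(R)$, the multicomplex whose entry is $P$ at every place in $\{0,1\}^n$ and $0$ elsewhere, and all of whose non-trivial edges in direction $i$ (from coordinate $1$ to coordinate $0$) have $d^i=A_i$ and $\tilde d^i=1$. By a theorem of Grech, sending the class of $(P;A_1,\ldots,A_n)$ to the class of $[P;A_1,\ldots,A_n]$ in $K_n(R)$ is a well-defined homomorphism $\phi_n:\widetilde K^{\mathrm M}_n(R)\to K_n(R)$. Hence its image is the subgroup of $K_n(R)$ generated by all classes $[P;A_1,\ldots,A_n]$ (whatever precise form of the Steinberg relations is used). *)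

(* Defs.v *)
From HB Require Import structures.
From mathcomp Require Import all_boot all_algebra.
From mathcomp Require Import boolp.

Set Implicit Arguments.
Unset Strict Implicit.
Unset Printing Implicit Defensive.
Import GRing.Theory.
Local Open Scope ring_scope.

Record category := Category {
  ob :> Type;
  hom : ob -> ob -> Type;
  idc : forall X, hom X X;
  comp : forall X Y Z, hom Y Z -> hom X Y -> hom X Z;
  compA : forall X Y Z T (h : hom Z T) (g : hom Y Z) (f : hom X Y),
    comp h (comp g f) = comp (comp h g) f;
  comp1l : forall X Y (f : hom X Y), comp (idc Y) f = f;
  comp1r : forall X Y (f : hom X Y), comp f (idc X) = f }.

Arguments idc {c} X.
Notation "g \oc f" := (comp g f) (at level 40, left associativity).

Definition is_iso (C : category) (X Y : C) (f : hom X Y) : Prop :=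
  exists g : hom Y X, g \oc f = idc X /\ f \oc g = idc Y.

Record functor (C D : category) := Functor {
  fob :> C -> D;
  fmap : forall X Y : C, hom X Y -> hom (fob X) (fob Y);
  fmap1 : forall X : C, fmap (idc X) = idc (fob X);
  fmapM : forall (X Y Z : C) (g : hom Y Z) (f : hom X Y),
    fmap (g \oc f) = fmap g \oc fmap f }.

(* An additive category with chosen finite direct sums and chosen kernels of
   finite families of morphisms out of an object (i.e. intersections of the
   individual kernels), together with a class [ses] of short exact sequences. *)
Record addcat := AddCat {
  acat :> category;
  hom_zmod : forall X Y : acat, GRing.Zmodule.axioms_ (hom X Y);
  hzmod := fun X Y : acat => GRing.Zmodule.Pack (hom_zmod X Y);
  compDl : forall (X Y Z : acat) (g g' : hzmod Y Z) (f : hom X Y),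
    (g + g' : hzmod Y Z) \oc f = (g \oc f : hzmod X Z) + (g' \oc f : hzmod X Z);
  compDr : forall (X Y Z : acat) (g : hom Y Z) (f f' : hzmod X Y),
    g \oc (f + f' : hzmod X Y) = (g \oc f : hzmod X Z) + (g \oc f' : hzmod X Z);
  dsum : forall I : finType, (I -> acat) -> acat;
  inj : forall (I : finType) (X : I -> acat) i, hom (X i) (dsum X);
  proj : forall (I : finType) (X : I -> acat) i, hom (dsum X) (X i);
  proj_inj : forall (I : finType) (X : I -> acat) i,
    proj X i \oc inj X i = idc (X i);
  proj_injN : forall (I : finType) (X : I -> acat) i j,
    i != j -> proj X j \oc inj X i = 0 :> hzmod (X i) (X j);
  dsum_id : forall (I : finType) (X : I -> acat),
    \sum_i (inj X i \oc proj X i : hzmod (dsum X) (dsum X)) = idc (dsum X);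
  ker : forall (I : finType) (X : acat) (Y : I -> acat),
    (forall i, hom X (Y i)) -> acat;
  kin : forall (I : finType) (X : acat) (Y : I -> acat)
    (f : forall i, hom X (Y i)), hom (ker f) X;
  kinP : forall (I : finType) (X : acat) (Y : I -> acat)
    (f : forall i, hom X (Y i)) i, f i \oc kin f = 0 :> hzmod (ker f) (Y i);
  klift : forall (I : finType) (X : acat) (Y : I -> acat)
    (f : forall i, hom X (Y i)) (Z : acat) (g : hom Z X),
    (forall i, f i \oc g = 0 :> hzmod Z (Y i)) -> hom Z (ker f);
  klift_kin : forall (I : finType) (X : acat) (Y : I -> acat)
    (f : forall i, hom X (Y i)) (Z : acat) (g : hom Z X)
    (fg0 : forall i, f i \oc g = 0 :> hzmod Z (Y i)), kin f \oc klift fg0 = g;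
  kin_inj : forall (I : finType) (X : acat) (Y : I -> acat)
    (f : forall i, hom X (Y i)) (Z : acat) (g h : hom Z (ker f)),
    kin f \oc g = kin f \oc h -> g = h;
  ses : forall X Y Z : acat, hom X Y -> hom Y Z -> Prop }.

HB.instance Definition _ (C : addcat) (X Y : C) := hom_zmod X Y.
Arguments kin {a I X Y} f.
Arguments klift {a I X Y f Z} g.

Section AddCatTheory.
Variable C : addcat.
Implicit Types X Y Z : C.

Lemma addm_comp X Y Z (g g' : hom Y Z) (f : hom X Y) :
  (g + g') \oc f = g \oc f + g' \oc f.
Proof. exact: compDl. Qed.

Lemma comp_addm X Y Z (g : hom Y Z) (f f' : hom X Y) :
  g \oc (f + f') = g \oc f + g \oc f'.
Proof. exact: compDr. Qed.

Lemma comp0m X Y Z (f : hom X Y) : (0 : hom Y Z) \oc f = 0.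
Proof. by apply: (addrI ((0 : hom Y Z) \oc f)); rewrite -addm_comp !addr0. Qed.

Lemma compm0 X Y Z (g : hom Y Z) : g \oc (0 : hom X Y) = 0.
Proof. by apply: (addrI (g \oc (0 : hom X Y))); rewrite -comp_addm !addr0. Qed.

Lemma opp_comp X Y Z (g : hom Y Z) (f : hom X Y) : (- g) \oc f = - (g \oc f).
Proof. by apply: (addrI (g \oc f)); rewrite -addm_comp !subrr comp0m. Qed.

Lemma comp_opp X Y Z (g : hom Y Z) (f : hom X Y) : g \oc (- f) = - (g \oc f).
Proof. by apply: (addrI (g \oc f)); rewrite -comp_addm !subrr compm0. Qed.

Lemma sum_comp (I : Type) (r : seq I) (P : pred I) X Y Z
    (g : I -> hom Y Z) (f : hom X Y) :
  (\sum_(i <- r | P i) g i) \oc f = \sum_(i <- r | P i) (g i \oc f).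
Proof.
by apply: (big_morph (fun h : hom Y Z => h \oc f)) => [a b|];
  rewrite ?addm_comp ?comp0m.
Qed.

Lemma comp_sum (I : Type) (r : seq I) (P : pred I) X Y Z
    (g : hom Y Z) (f : I -> hom X Y) :
  g \oc (\sum_(i <- r | P i) f i) = \sum_(i <- r | P i) (g \oc f i).
Proof.
by apply: (big_morph (fun h : hom X Y => g \oc h)) => [a b|];
  rewrite ?comp_addm ?compm0.
Qed.

Definition is_zero X : Prop := idc X = 0.

Definition zob : C := dsum (fun v : void => match v with end).

Lemma zob0 : is_zero zob.
Proof. by rewrite /is_zero -dsum_id big1 // => -[]. Qed.

End AddCatTheory.

Section LinearMaps.
Variables (R : comPzRingType) (U V : lmodType R).
Implicit Types f g h : {linear U -> V}.

Lemma linear_ext f g : f =1 g -> f = g.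
Proof.
case: f => f cf; case: g => g cg /= fg; have {}fg : f = g by apply: funext.
subst g; congr GRing.Linear.Pack; case: cf => [[a1] [a2]]; case: cg => [[b1] [b2]].
by rewrite (Prop_irrelevance a1 b1) (Prop_irrelevance a2 b2).
Qed.

HB.instance Definition _ := gen_eqMixin {linear U -> V}.
HB.instance Definition _ := gen_choiceMixin {linear U -> V}.

Definition lin_add f g : {linear U -> V} := f \+ g.
Definition lin_opp f : {linear U -> V} := \- f.
Definition lin_zero : {linear U -> V} := \0.

Fact lin_addA : associative lin_add.
Proof. by move=> f g h; apply: linear_ext => x /=; rewrite addrA. Qed.
Fact lin_addC : commutative lin_add.
Proof. by move=> f g; apply: linear_ext => x /=; rewrite addrC. Qed.
Fact lin_add0 : left_id lin_zero lin_add.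
Proof. by move=> f; apply: linear_ext => x /=; rewrite add0r. Qed.
Fact lin_addN : left_inverse lin_zero lin_opp lin_add.
Proof. by move=> f; apply: linear_ext => x /=; rewrite addNr. Qed.

HB.instance Definition _ :=
  GRing.isZmodule.Build {linear U -> V} lin_addA lin_addC lin_add0 lin_addN.

End LinearMaps.

Section ModuleConstructions.
Variable R : comPzRingType.

(* Finite direct sums are realized as products. *)
Section Dprod.
Variables (I : finType) (X : I -> lmodType R).

Definition dprod : Type := forall i, X i.
Implicit Types x y z : dprod.

HB.instance Definition _ := gen_eqMixin dprod.
HB.instance Definition _ := gen_choiceMixin dprod.

Definition dprod_zero : dprod := fun=> 0.
Definition dprod_opp x : dprod := fun i => - x i.
Definition dprod_add x y : dprod := fun i => x i + y i.
Definition dprod_scale (a : R) x : dprod := fun i => a *: x i.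

Fact dprod_addA : associative dprod_add.
Proof. by move=> x y z; apply: functional_extensionality_dep => i; apply: addrA. Qed.
Fact dprod_addC : commutative dprod_add.
Proof. by move=> x y; apply: functional_extensionality_dep => i; apply: addrC. Qed.
Fact dprod_add0 : left_id dprod_zero dprod_add.
Proof. by move=> x; apply: functional_extensionality_dep => i; apply: add0r. Qed.
Fact dprod_addN : left_inverse dprod_zero dprod_opp dprod_add.
Proof. by move=> x; apply: functional_extensionality_dep => i; apply: addNr. Qed.

HB.instance Definition _ :=
  GRing.isZmodule.Build dprod dprod_addA dprod_addC dprod_add0 dprod_addN.

Fact dprod_scaleA a b x : dprod_scale a (dprod_scale b x) = dprod_scale (a * b) x.
Proof. by apply: functional_extensionality_dep => i; apply: scalerA. Qed.
Fact dprod_scale1 : left_id 1 dprod_scale.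
Proof. by move=> x; apply: functional_extensionality_dep => i; apply: scale1r. Qed.
Fact dprod_scaleDr : right_distributive dprod_scale +%R.
Proof. by move=> a x y; apply: functional_extensionality_dep => i; apply: scalerDr. Qed.
Fact dprod_scaleDl x : {morph dprod_scale^~ x : a b / a + b}.
Proof. by move=> a b; apply: functional_extensionality_dep => i; apply: scalerDl. Qed.

HB.instance Definition _ := GRing.Zmodule_isLmodule.Build R dprod
  dprod_scaleA dprod_scale1 dprod_scaleDr dprod_scaleDl.

Definition dprod_proj_fun i (x : dprod) : X i := x i.
Fact dprod_proj_linear i : linear (dprod_proj_fun i).
Proof. by []. Qed.
HB.instance Definition _ i := GRing.isLinear.Build R dprod (X i) _
  (dprod_proj_fun i) (dprod_proj_linear i).
Definition dprod_proj i : {linear dprod -> X i} := dprod_proj_fun i.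

Definition dprod_inj_fun i (u : X i) : dprod := fun j =>
  match i =P j with ReflectT e => ecast k (X k) e u | _ => 0 end.
Fact dprod_inj_linear i : linear (@dprod_inj_fun i).
Proof.
move=> a u v; apply: functional_extensionality_dep => j; rewrite /dprod_inj_fun.
change ((match i =P j with ReflectT e => ecast k (X k) e (a *: u + v) | _ => 0 end)
  = a *: (match i =P j with ReflectT e => ecast k (X k) e u | _ => 0 end)
    + match i =P j with ReflectT e => ecast k (X k) e v | _ => 0 end).
by case: eqP => [e|_]; [case: j / e | rewrite scaler0 addr0].
Qed.
HB.instance Definition _ i := GRing.isLinear.Build R (X i) dprod _
  (@dprod_inj_fun i) (@dprod_inj_linear i).
Definition dprod_inj i : {linear X i -> dprod} := @dprod_inj_fun i.

Lemma dprod_injE i (u : X i) : dprod_inj i u i = u.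
Proof. by rewrite /= /dprod_inj_fun; case: eqP => // e; rewrite eq_axiomK. Qed.

Lemma dprod_injN i j (u : X i) : i != j -> dprod_inj i u j = 0.
Proof. by rewrite /= /dprod_inj_fun; case: eqP. Qed.

Lemma sum_dprodE (J : Type) (r : seq J) (f : J -> dprod) i :
  (\sum_(k <- r) f k : dprod) i = \sum_(k <- r) f k i.
Proof. exact: (big_morph (fun x : dprod => x i)). Qed.

End Dprod.

Section Kernel.
Variables (I : finType) (X : lmodType R) (Y : I -> lmodType R).
Variable f : forall i, {linear X -> Y i}.

Record kernel := Kernel { kval : X; kvalP : forall i, f i kval = 0 }.

Lemma kval_inj : injective kval.
Proof.
case=> x px [y py] /= exy; subst y.
by congr Kernel; apply: Prop_irrelevance.
Qed.

HB.instance Definition _ := gen_eqMixin kernel.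
HB.instance Definition _ := gen_choiceMixin kernel.

Fact ker_zero_proof i : f i 0 = 0. Proof. exact: linear0. Qed.
Fact ker_opp_proof (x : kernel) i : f i (- kval x) = 0.
Proof. by rewrite linearN kvalP oppr0. Qed.
Fact ker_add_proof (x y : kernel) i : f i (kval x + kval y) = 0.
Proof. by rewrite linearD !kvalP addr0. Qed.
Fact ker_scale_proof a (x : kernel) i : f i (a *: kval x) = 0.
Proof. by rewrite linearZ /= kvalP scaler0. Qed.

Definition ker_zero := Kernel ker_zero_proof.
Definition ker_opp x := Kernel (ker_opp_proof x).
Definition ker_add x y := Kernel (ker_add_proof x y).
Definition ker_scale a x := Kernel (ker_scale_proof a x).

Fact ker_addA : associative ker_add.
Proof. by move=> x y z; apply: kval_inj; apply: addrA. Qed.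
Fact ker_addC : commutative ker_add.
Proof. by move=> x y; apply: kval_inj; apply: addrC. Qed.
Fact ker_add0 : left_id ker_zero ker_add.
Proof. by move=> x; apply: kval_inj; apply: add0r. Qed.
Fact ker_addN : left_inverse ker_zero ker_opp ker_add.
Proof. by move=> x; apply: kval_inj; apply: addNr. Qed.

HB.instance Definition _ :=
  GRing.isZmodule.Build kernel ker_addA ker_addC ker_add0 ker_addN.

Fact ker_scaleA a b x : ker_scale a (ker_scale b x) = ker_scale (a * b) x.
Proof. by apply: kval_inj; apply: scalerA. Qed.
Fact ker_scale1 : left_id 1 ker_scale.
Proof. by move=> x; apply: kval_inj; apply: scale1r. Qed.
Fact ker_scaleDr : right_distributive ker_scale +%R.
Proof. by move=> a x y; apply: kval_inj; apply: scalerDr. Qed.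
Fact ker_scaleDl x : {morph ker_scale^~ x : a b / a + b}.
Proof. by move=> a b; apply: kval_inj; apply: scalerDl. Qed.

HB.instance Definition _ := GRing.Zmodule_isLmodule.Build R kernel
  ker_scaleA ker_scale1 ker_scaleDr ker_scaleDl.

Fact kval_linear : linear kval. Proof. by []. Qed.
HB.instance Definition _ := GRing.isLinear.Build R kernel X _ kval kval_linear.
Definition ker_incl : {linear kernel -> X} := kval.

Section Lift.
Variables (Z : lmodType R) (g : {linear Z -> X}).
Hypothesis fg0 : forall i, (f i \o g : {linear Z -> Y i}) = 0.

Fact ker_lift_proof z i : f i (g z) = 0.
Proof. by have := congr1 (fun h : {linear Z -> Y i} => h z) (fg0 i). Qed.
Definition ker_lift_fun z := Kernel (ker_lift_proof z).
Fact ker_lift_linear : linear ker_lift_fun.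
Proof. by move=> a u v; apply: kval_inj; apply: linearP. Qed.
HB.instance Definition _ := GRing.isLinear.Build R Z kernel _
  ker_lift_fun ker_lift_linear.
Definition ker_lift : {linear Z -> kernel} := ker_lift_fun.
End Lift.

End Kernel.

Lemma sum_linE (U V : lmodType R) (J : Type) (r : seq J)
    (f : J -> {linear U -> V}) x :
  (\sum_(k <- r) f k) x = \sum_(k <- r) f k x.
Proof. exact: (big_morph (fun h : {linear U -> V} => h x)). Qed.

Definition mod_cat : category.
Proof.
refine (@Category (lmodType R) (fun U V => {linear U -> V}) (fun U => idfun)
  (fun U V W g f => g \o f) _ _ _).
- by move=> *; apply: linear_ext.
- by move=> *; apply: linear_ext.
- by move=> *; apply: linear_ext.
Defined.

Definition mod_ses (U V W : mod_cat) (f : hom U V) (g : hom V W) : Prop :=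
  [/\ injective (f : U -> V), forall w : W, exists v : V, (g : V -> W) v = w
    & forall v : V, (g : V -> W) v = 0 <-> exists u : U, (f : U -> V) u = v].

End ModuleConstructions.

Section ModCat.
Variable R : comPzRingType.

Fact mod_compDl (U V W : lmodType R) (g g' : {linear V -> W}) (f : {linear U -> V}) :
  ((g + g')%R \o f : {linear U -> W}) =
  (g \o f : {linear U -> W}) + (g' \o f : {linear U -> W}).
Proof. exact: linear_ext. Qed.

Fact mod_compDr (U V W : lmodType R) (g : {linear V -> W}) (f f' : {linear U -> V}) :
  (g \o (f + f')%R : {linear U -> W}) =
  (g \o f : {linear U -> W}) + (g \o f' : {linear U -> W}).
Proof. by apply: linear_ext => x; apply: linearD. Qed.

Fact mod_proj_inj (I : finType) (X : I -> lmodType R) i :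
  (dprod_proj X i \o dprod_inj X i : {linear X i -> X i}) = idfun.
Proof. by apply: linear_ext => u; apply: dprod_injE. Qed.

Fact mod_proj_injN (I : finType) (X : I -> lmodType R) i j : i != j ->
  (dprod_proj X j \o dprod_inj X i : {linear X i -> X j}) = 0.
Proof. by move=> ij; apply: linear_ext => u; apply: dprod_injN. Qed.

Fact mod_dsum_id (I : finType) (X : I -> lmodType R) :
  \sum_i (dprod_inj X i \o dprod_proj X i : {linear dprod X -> dprod X}) = idfun.
Proof.
apply: linear_ext => x; rewrite sum_linE.
apply: functional_extensionality_dep => i; rewrite sum_dprodE (bigD1 i) //=.
rewrite -/(dprod_inj X i _ i) dprod_injE big1 ?addr0 // => j ji.
exact: dprod_injN.
Qed.

Fact mod_kinP (I : finType) (X : lmodType R) (Y : I -> lmodType R)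
    (f : forall i, {linear X -> Y i}) i :
  (f i \o ker_incl f : {linear kernel f -> Y i}) = 0.
Proof. by apply: linear_ext => x; apply: kvalP. Qed.

Fact mod_klift_kin (I : finType) (X : lmodType R) (Y : I -> lmodType R)
    (f : forall i, {linear X -> Y i}) (Z : lmodType R) (g : {linear Z -> X})
    (fg0 : forall i, (f i \o g : {linear Z -> Y i}) = 0) :
  (ker_incl f \o ker_lift fg0 : {linear Z -> X}) = g.
Proof. exact: linear_ext. Qed.

Fact mod_kin_inj (I : finType) (X : lmodType R) (Y : I -> lmodType R)
    (f : forall i, {linear X -> Y i}) (Z : lmodType R)
    (g h : {linear Z -> kernel f}) :
  (ker_incl f \o g : {linear Z -> X}) = (ker_incl f \o h : {linear Z -> X}) ->
  g = h.
Proof.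
by move=> gh; apply: linear_ext => z; apply: kval_inj;
   have := congr1 (fun k : {linear Z -> X} => k z) gh.
Qed.

Definition Mod : addcat :=
  @AddCat (mod_cat R) (fun U V => GRing.Zmodule.class {linear U -> V})
    mod_compDl mod_compDr (fun I X => dprod X) (@dprod_inj R) (@dprod_proj R)
    mod_proj_inj mod_proj_injN mod_dsum_id
    (fun I X Y f => kernel f) (fun I X Y f => ker_incl f) mod_kinP
    (fun I X Y f Z g fg0 => ker_lift fg0) mod_klift_kin mod_kin_inj
    (@mod_ses R).

End ModCat.

Section BinaryComplexes.
Variable C : addcat.

(* [bd X false] is the differential d and [bd X true] the differential
   \tilde d; [bd X b k] goes from degree k + 1 to degree k. *)
Record bcomplex := BComplex {
  bob :> nat -> C;
  bd : bool -> forall k, hom (bob k.+1) (bob k);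
  bdd : forall b k, bd b k \oc bd b k.+1 = 0 }.

Record bmor (X Y : bcomplex) := BMor {
  bmap :> forall k, hom (X k) (Y k);
  bmapP : forall b k, bd Y b k \oc bmap k.+1 = bmap k \oc bd X b k }.

Lemma bmor_ext X Y (f g : bmor X Y) : (forall k, f k = g k) -> f = g.
Proof.
case: f => f pf; case: g => g pg /= fg.
have {}fg : f = g by apply: functional_extensionality_dep.
by subst g; congr BMor; apply: Prop_irrelevance.
Qed.

Section BMorZmod.
Variables X Y : bcomplex.
Implicit Types f g h : bmor X Y.

HB.instance Definition _ := gen_eqMixin (bmor X Y).
HB.instance Definition _ := gen_choiceMixin (bmor X Y).

Fact bmor_zeroP b k :
  bd Y b k \oc (0 : hom (X k.+1) (Y k.+1)) = 0 \oc bd X b k.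
Proof. by rewrite compm0 comp0m. Qed.
Fact bmor_oppP f b k : bd Y b k \oc (- f k.+1) = (- f k) \oc bd X b k.
Proof. by rewrite comp_opp opp_comp bmapP. Qed.
Fact bmor_addP f g b k :
  bd Y b k \oc (f k.+1 + g k.+1) = (f k + g k) \oc bd X b k.
Proof. by rewrite comp_addm addm_comp !bmapP. Qed.

Definition bmor_zero : bmor X Y := BMor bmor_zeroP.
Definition bmor_opp f : bmor X Y := BMor (bmor_oppP f).
Definition bmor_add f g : bmor X Y := BMor (bmor_addP f g).

Fact bmor_addA : associative bmor_add.
Proof. by move=> f g h; apply: bmor_ext => k; apply: addrA. Qed.
Fact bmor_addC : commutative bmor_add.
Proof. by move=> f g; apply: bmor_ext => k; apply: addrC. Qed.
Fact bmor_add0 : left_id bmor_zero bmor_add.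
Proof. by move=> f; apply: bmor_ext => k; apply: add0r. Qed.
Fact bmor_addN : left_inverse bmor_zero bmor_opp bmor_add.
Proof. by move=> f; apply: bmor_ext => k; apply: addNr. Qed.

HB.instance Definition _ :=
  GRing.isZmodule.Build (bmor X Y) bmor_addA bmor_addC bmor_add0 bmor_addN.

Lemma sum_bmorE (J : Type) (r : seq J) (f : J -> bmor X Y) k :
  (\sum_(j <- r) f j) k = \sum_(j <- r) f j k.
Proof. exact: (big_morph (fun g : bmor X Y => g k)). Qed.

End BMorZmod.

Fact bid_proof (X : bcomplex) b k :
  bd X b k \oc idc (X k.+1) = idc (X k) \oc bd X b k.
Proof. by rewrite comp1l comp1r. Qed.

Fact bcomp_proof (X Y Z : bcomplex) (g : bmor Y Z) (f : bmor X Y) b k :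
  bd Z b k \oc (g k.+1 \oc f k.+1) = (g k \oc f k) \oc bd X b k.
Proof. by rewrite compA bmapP -compA bmapP compA. Qed.

Definition bcat : category.
Proof.
refine (@Category bcomplex bmor (fun X => BMor (bid_proof X))
  (fun X Y Z g f => BMor (bcomp_proof g f)) _ _ _).
- by move=> *; apply: bmor_ext => k; apply: compA.
- by move=> *; apply: bmor_ext => k; apply: comp1l.
- by move=> *; apply: bmor_ext => k; apply: comp1r.
Defined.

Section BDsum.
Variables (I : finType) (X : I -> bcomplex).

Definition bdsum_d b k : hom (dsum (fun i => X i k.+1)) (dsum (fun i => X i k)) :=
  \sum_i (inj (fun i => X i k) i \oc bd (X i) b k \oc proj (fun i => X i k.+1) i).

Lemma bdsum_d_inj b k i : bdsum_d b k \oc inj (fun i => X i k.+1) i =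
  inj (fun i => X i k) i \oc bd (X i) b k.
Proof.
rewrite /bdsum_d sum_comp (bigD1 i) //= -compA proj_inj comp1r big1 ?addr0 //.
by move=> j ji; rewrite -compA proj_injN ?compm0 // eq_sym.
Qed.

Lemma proj_bdsum_d b k i : proj (fun i => X i k) i \oc bdsum_d b k =
  bd (X i) b k \oc proj (fun i => X i k.+1) i.
Proof.
rewrite /bdsum_d comp_sum (bigD1 i) //= !compA proj_inj comp1l big1 ?addr0 //.
by move=> j ji; rewrite !compA proj_injN // !comp0m.
Qed.

Fact bdsum_dd b k : bdsum_d b k \oc bdsum_d b k.+1 = 0.
Proof.
rewrite {2}/bdsum_d comp_sum big1 // => i _.
by rewrite !compA bdsum_d_inj -(compA (inj _ _)) bdd compm0 comp0m.
Qed.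

Definition bdsum : bcomplex := BComplex bdsum_dd.
Definition binj i : bmor (X i) bdsum :=
  @BMor (X i) bdsum (fun k => inj (fun i => X i k) i)
    (fun b k => bdsum_d_inj b k i).
Definition bproj i : bmor bdsum (X i) :=
  @BMor bdsum (X i) (fun k => proj (fun i => X i k) i)
    (fun b k => esym (proj_bdsum_d b k i)).
End BDsum.

Section BKer.
Variables (I : finType) (X : bcomplex) (Y : I -> bcomplex).
Variable f : forall i, bmor X (Y i).

Let bker_ob k := ker (fun i => f i k).

Fact bker_d_proof b k i : f i k \oc (bd X b k \oc kin (fun i => f i k.+1)) = 0.
Proof. by rewrite compA -bmapP -compA kinP compm0. Qed.

Definition bker_d b k : hom (bker_ob k.+1) (bker_ob k) := klift _ (bker_d_proof b k).

Lemma kin_bker_d b k :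
  kin (fun i => f i k) \oc bker_d b k = bd X b k \oc kin (fun i => f i k.+1).
Proof. exact: klift_kin. Qed.

Fact bker_dd b k : bker_d b k \oc bker_d b k.+1 = 0.
Proof.
by apply: kin_inj; rewrite compA kin_bker_d -compA kin_bker_d compA bdd comp0m compm0.
Qed.

Definition bker : bcomplex := BComplex bker_dd.
Definition bkin : bmor bker X :=
  @BMor bker X (fun k => kin (fun i => f i k)) (fun b k => esym (kin_bker_d b k)).

Section Lift.
Variables (Z : bcomplex) (g : bmor Z X).
Hypothesis fg0 : forall i, (f i : @hom bcat _ _) \oc (g : @hom bcat _ _) = (0 : bmor Z (Y i)).

Fact bklift_proof k i : f i k \oc g k = 0.
Proof. by have := congr1 (fun h : bmor Z (Y i) => h k) (fg0 i). Qed.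

Fact bkliftP b k :
  bker_d b k \oc klift _ (bklift_proof k.+1) = klift _ (bklift_proof k) \oc bd Z b k.
Proof.
by apply: kin_inj; rewrite [RHS]compA klift_kin [LHS]compA kin_bker_d -compA klift_kin bmapP.
Qed.

Definition bklift : bmor Z bker := @BMor Z bker _ bkliftP.
End Lift.
End BKer.

Definition bses (X Y Z : bcat) (f : hom X Y) (g : hom Y Z) : Prop :=
  forall k, ses ((f : bmor X Y) k) ((g : bmor Y Z) k).

Definition BC : addcat.
Proof.
refine (@AddCat bcat (fun X Y => GRing.Zmodule.class (bmor X Y)) _ _
  bdsum binj bproj _ _ _ bker bkin _ bklift _ _ bses).
- by move=> *; apply: bmor_ext => k; apply: addm_comp.
- by move=> *; apply: bmor_ext => k; apply: comp_addm.
- by move=> *; apply: bmor_ext => k; apply: proj_inj.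
- by move=> *; apply: bmor_ext => k; apply: proj_injN.
- by move=> I X; apply: bmor_ext => k; rewrite sum_bmorE; apply: dsum_id.
- by move=> *; apply: bmor_ext => k; apply: kinP.
- by move=> *; apply: bmor_ext => k; apply: klift_kin.
- move=> I X Y f Z g h gh; apply: bmor_ext => k; apply: kin_inj.
  by have := congr1 (fun h : bmor Z X => h k) gh.
Defined.

End BinaryComplexes.

(* Monotone surjections [k] ->> [p], where [k] = {0, ..., k} = 'I_k.+1. *)
Definition epi (k p : nat) : finType :=
  {f : {ffun 'I_k.+1 -> 'I_p.+1} |
    [forall i : 'I_k.+1, forall j : 'I_k.+1, (i <= j)%N ==> (f i <= f j)%N] &&
    [forall y, y \in codom f]}.

(* All eta : [k] ->> [p] with p arbitrary; p is [tag eta] (and p <= k). *)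
Definition epis (k : nat) : finType := {p : 'I_k.+1 & epi k p}.

Definition epi_fun k (eta : epis k) (i : 'I_k.+1) : nat :=
  val (tagged eta) i.

(* The coface map [k - 1] -> [k] missing i (not used for k = 0). *)
Definition coface (k i : nat) : 'I_k.-1.+1 -> 'I_k.+1 := fun j => inord (bump i j).
Arguments coface : clear implicits.

Section Gamma.
Variables (C : addcat) (X : nat -> C) (d : forall k, hom (X k.+1) (X k)).

Definition idm p q : hom (X p) (X q) :=
  match p =P q with ReflectT e => ecast q (hom (X p) (X q)) e (idc (X p)) | _ => 0 end.

Definition dm p q : hom (X p) (X q) :=
  match q.+1 =P p with ReflectT e => ecast p (hom (X p) (X q)) e (d q) | _ => 0 end.

Definition gamma k : C := dsum (fun eta : epis k => X (tag eta)).

(* The component of alpha^* from the eta-summand to the theta-summand. The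
   first test says that eta alpha = epsilon theta for an initial inclusion
   epsilon : [q] -> [p], which is the identity iff p = q; the second one that
   eta alpha = epsilon theta with epsilon the shift i |-> i + 1, and then
   epsilon misses only 0 iff p = q + 1. *)
Definition gamma_entry l k (alpha : 'I_l.+1 -> 'I_k.+1) (eta : epis k) (theta : epis l) :
    hom (X (tag eta)) (X (tag theta)) :=
  if [forall i, epi_fun eta (alpha i) == epi_fun theta i] then idm _ _
  else if [forall i, epi_fun eta (alpha i) == (epi_fun theta i).+1] then dm _ _
  else 0.

Definition gamma_act l k (alpha : 'I_l.+1 -> 'I_k.+1) : hom (gamma k) (gamma l) :=
  \sum_eta \sum_theta
    (inj (fun t : epis l => X (tag t)) theta \oc gamma_entry alpha eta theta
       \oc proj (fun t : epis k => X (tag t)) eta).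

End Gamma.

Section EpiTheory.

Lemma epi_mono k (eta : epis k) (i j : 'I_k.+1) :
  (i <= j)%N -> (epi_fun eta i <= epi_fun eta j)%N.
Proof.
rewrite /epi_fun; case: eta => p [f /= /andP[/forallP m _]] ij.
by have /forallP/(_ j)/implyP/(_ ij) := m i.
Qed.

Lemma epi_surj k (eta : epis k) y : (y <= tag eta)%N -> exists i, epi_fun eta i = y.
Proof.
rewrite /epi_fun; case: eta => p [f /= /andP[_ /forallP s]] yp.
have /codomP[i ei] := s (Ordinal (yp : (y < p.+1)%N)).
by exists i; rewrite -ei.
Qed.

Lemma epi_le k (eta : epis k) i : (epi_fun eta i <= tag eta)%N.
Proof. by rewrite -ltnS; apply: ltn_ord. Qed.

Lemma epi0 k (eta : epis k) : epi_fun eta ord0 = 0%N.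
Proof.
have [i e] := epi_surj (leq0n (tag eta)).
by apply/eqP; rewrite -leqn0 -e; apply: epi_mono.
Qed.

Lemma epi_inj k (eta theta : epis k) : epi_fun eta =1 epi_fun theta -> eta = theta.
Proof.
have le (s t : epis k) : epi_fun s =1 epi_fun t -> (tag s <= tag t)%N.
  by move=> e; have [i <-] := epi_surj (leqnn (tag s)); rewrite e epi_le.
move=> e; have et : tag eta = tag theta.
  by apply/val_inj/eqP; rewrite eqn_leq !le // => i; rewrite e.
case: eta theta e et => p f [q g] /= e epq; subst q; congr existT.
by apply/val_inj/ffunP => i; apply: val_inj; apply: e.
Qed.

Lemma epi_ex k p (f : 'I_k.+1 -> nat) :
  (forall i j : 'I_k.+1, (i <= j)%N -> (f i <= f j)%N) -> (forall i, (f i <= p)%N) ->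
  (forall y, (y <= p)%N -> exists i, f i = y) ->
  exists2 eta : epis k, tag eta = p :> nat & epi_fun eta =1 f.
Proof.
move=> m le s.
have pk : (p < k.+1)%N.
  have /fin_all_exists[g gP] : forall y : 'I_p.+1, exists i, f i = y.
    by move=> y; apply: s; rewrite -ltnS.
  have /leq_card : injective g by move=> y z e; apply: ord_inj; rewrite -gP e gP.
  by rewrite !card_ord.
pose g : {ffun 'I_k.+1 -> 'I_(Ordinal pk).+1} := [ffun i => inord (f i)].
have gE i : g i = f i :> nat by rewrite ffunE inordK // ltnS.
have gP : [forall i : 'I_k.+1, forall j : 'I_k.+1, (i <= j)%N ==> (g i <= g j)%N] &&
    [forall y, y \in codom g].
  apply/andP; split.
    apply/forallP => i; apply/forallP => j; apply/implyP => ij.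
    by rewrite !gE; apply: m.
  apply/forallP => y; have [|i ei] := s y; first by rewrite -ltnS; apply: ltn_ord.
  by apply/codomP; exists i; apply: ord_inj; rewrite gE.
by exists (existT _ (Ordinal pk) (Sub g gP : epi k (Ordinal pk))) => // i; rewrite -gE.
Qed.

End EpiTheory.

Section GammaTheory.
Variable C : addcat.

Lemma dsum_ext (I : finType) (X : I -> C) (Y : C) (f g : hom (dsum X) Y) :
  (forall i, f \oc inj X i = g \oc inj X i) -> f = g.
Proof.
move=> fg; rewrite -[f]comp1r -[g]comp1r -dsum_id !comp_sum.
by apply: eq_bigr => i _; rewrite !compA fg.
Qed.

Section OneComplex.
Variables (X : nat -> C) (d : forall k, hom (X k.+1) (X k)).

Lemma idmE p q : p <> q -> idm X p q = 0.
Proof. by rewrite /idm; case: eqP. Qed.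

Lemma dmE p q : q.+1 <> p -> dm d p q = 0.
Proof. by rewrite /dm; case: eqP. Qed.

Lemma idmm p : idm X p p = idc (X p).
Proof. by rewrite /idm; case: eqP => // e; rewrite eq_axiomK. Qed.

Lemma dmm p : dm d p.+1 p = d p.
Proof. by rewrite /dm; case: eqP => // e; rewrite eq_axiomK. Qed.

Lemma gamma_act_inj l k (alpha : 'I_l.+1 -> 'I_k.+1) (eta : epis k) :
  gamma_act d alpha \oc inj (fun t : epis k => X (tag t)) eta =
  \sum_theta (inj (fun t : epis l => X (tag t)) theta \oc gamma_entry d alpha eta theta).
Proof.
rewrite /gamma_act sum_comp (bigD1 eta) //= [X in _ + X]big1 ?addr0.
  by rewrite sum_comp; apply: eq_bigr => t _; rewrite -(compA _ (proj _ _)) proj_inj comp1r.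
move=> e ne; rewrite sum_comp big1 // => t _.
by rewrite -(compA _ (proj _ _)) proj_injN ?compm0 // eq_sym.
Qed.

Hypothesis dd : forall k, d k \oc d k.+1 = 0.

Lemma dm_dm p q r : dm d q r \oc dm d p q = 0.
Proof.
have [<-|n] := eqVneq q.+1 p; last by rewrite (@dmE p) ?compm0 //; apply/eqP.
have [<-|n] := eqVneq r.+1 q; last by rewrite (@dmE q) ?comp0m //; apply/eqP.
by rewrite !dmm dd.
Qed.

Lemma gamma_actM m l k (beta : 'I_l.+1 -> 'I_k.+1) (alpha : 'I_m.+1 -> 'I_l.+1) :
  (forall i j : 'I_l.+1, (i <= j)%N -> (beta i <= beta j)%N) ->
  gamma_act d alpha \oc gamma_act d beta = gamma_act d (beta \o alpha).
Proof.
move=> mbeta; apply: dsum_ext => eta; rewrite -compA !gamma_act_inj comp_sum.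
have hmono (i j : 'I_l.+1) : (i <= j)%N ->
    (epi_fun eta (beta i) <= epi_fun eta (beta j))%N.
  by move=> ij; apply/epi_mono/mbeta.
have [[t0 [pt et]]|nA] := pselect (exists t0 : epis l, tag t0 = tag eta :> nat /\
    forall i, epi_fun eta (beta i) = epi_fun t0 i).
  rewrite (bigD1 t0) //= [X in _ + X]big1 ?addr0; last first.
    move=> t tt0; rewrite /gamma_entry; case: ifP => [/forallP h|_].
      case/eqP: tt0; apply: epi_inj => i.
      by rewrite -et; apply/esym/eqP.
    case: ifP => [/forallP/(_ ord0)|_]; last by rewrite !compm0.
    by rewrite et !epi0.
  rewrite compA gamma_act_inj sum_comp; apply: eq_bigr => z _; rewrite -compA.
  congr (_ \oc _); rewrite [gamma_entry d beta _ _]/gamma_entry ifT; last first.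
    by apply/forallP => i; rewrite et.
  rewrite /gamma_entry.
  under [X in _ = if X then _ else _]eq_forallb do rewrite /= et.
  under [X in _ = if _ then _ else if X then _ else _]eq_forallb do rewrite /= et.
  case: (tag eta) pt => /= p _ ->; rewrite idmm.
  by case: ifP => _; [|case: ifP => _]; rewrite ?comp1r.
have [[t0 [pt et]]|nB] := pselect (exists t0 : epis l, (tag t0).+1 = tag eta :> nat /\
    forall i, epi_fun eta (beta i) = (epi_fun t0 i).+1).
  rewrite (bigD1 t0) //= [X in _ + X]big1 ?addr0; last first.
    move=> t tt0; rewrite /gamma_entry; case: ifP => [/forallP/(_ ord0)|_].
      by rewrite et !epi0.
    case: ifP => [/forallP h|_]; last by rewrite !compm0.
    case/eqP: tt0; apply: epi_inj => i.
    by apply/eqP; rewrite -eqSS -et eq_sym.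
  rewrite compA gamma_act_inj sum_comp; apply: eq_bigr => z _; rewrite -compA.
  congr (_ \oc _); rewrite [gamma_entry d beta _ _]/gamma_entry ifF; last first.
    by apply/negP => /forallP/(_ ord0); rewrite et epi0.
  rewrite ifT; last by apply/forallP => i; rewrite et.
  rewrite /gamma_entry [X in _ = if X then _ else _](_ : _ = false); last first.
    by apply/negP => /forallP/(_ ord0); rewrite /= et epi0.
  under [X in _ = if X then _ else _]eq_forallb do rewrite /= et eqSS.
  case: ifP => _.
    have [->|n] := eqVneq (tag t0 : nat) (tag z); first by rewrite idmm comp1l.
    rewrite idmE ?comp0m; last by apply/eqP. 
    by rewrite dmE // -pt => -[] /eqP; rewrite eq_sym (negPf n).
  by case: ifP => _; rewrite ?dm_dm ?comp0m.
rewrite big1 => [|t _].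
  rewrite big1 // => z _; rewrite [gamma_entry _ _ _ _](_ : _ = 0) ?compm0 //.
  rewrite /gamma_entry; case: ifP => [/forallP h|_].
    have [e|/eqP n] := eqVneq (tag eta : nat) (tag z); last exact: idmE.
    case: nA.
    have [i|y yp|t0 t0p t0E] := @epi_ex l (tag eta) (fun i => epi_fun eta (beta i)) hmono.
    + exact: epi_le.
    + have [|i ei] := @epi_surj _ z y; first by rewrite -e.
      by exists (alpha i); rewrite -ei; apply/eqP/h.
    + by exists t0; split.
  case: ifP => [/forallP h|//].
  have [e|/eqP n] := eqVneq (tag z).+1 (tag eta); last exact: dmE.
  have [[j0 ej0]|n0] := pselect (exists j, epi_fun eta (beta j) = 0%N).
    case: nA.
    have [i|y yp|t0 t0p t0E] := @epi_ex l (tag eta) (fun i => epi_fun eta (beta i)) hmono.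
    + exact: epi_le.
    + case: y yp => [_|y]; first by exists j0.
      rewrite -e ltnS => yp.
      have [i ei] := @epi_surj _ z y yp.
      by exists (alpha i); rewrite -ei; apply/eqP/h.
    + by exists t0; split.
  have pos i : (0 < epi_fun eta (beta i))%N.
    by rewrite lt0n; apply/eqP => ei; apply: n0; exists i.
  case: nB.
  have [|i|y yp|t0 t0p t0E] := @epi_ex l (tag z) (fun i => (epi_fun eta (beta i)).-1).
  + by move=> i j ij; rewrite -!subn1 leq_sub2r // hmono.
  + by rewrite -ltnS prednK // e epi_le.
  + have [i ei] := @epi_surj _ z y yp.
    by exists (alpha i); rewrite -ei; apply/eqP; rewrite -eqSS prednK //; apply: h.
  + by exists t0; split => [|i]; [rewrite t0p | rewrite t0E prednK].
rewrite [gamma_entry _ _ _ _](_ : _ = 0) ?compm0 //.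
rewrite /gamma_entry; case: ifP => [/forallP h|_].
  have [e|/eqP n] := eqVneq (tag eta : nat) (tag t); last exact: idmE.
  by case: nA; exists t; split => // i; apply/eqP/h.
case: ifP => [/forallP h|//].
have [e|/eqP n] := eqVneq (tag t).+1 (tag eta); last exact: dmE.
by case: nB; exists t; split => // i; apply/eqP/h.
Qed.

End OneComplex.
End GammaTheory.

Lemma cofaceE k i (j : 'I_k.+1) : coface k.+1 i j = bump i j :> nat.
Proof.
rewrite inordK // ltnS /bump (leq_trans _ (ltn_ord j)) //.
by rewrite -[X in (_ <= X)%N]add1n leq_add2r leq_b1.
Qed.

Lemma coface_mono k i (j j' : 'I_k.-1.+1) :
  (j <= j')%N -> (coface k i j <= coface k i j')%N.
Proof.
case: k j j' => [|k] j j' jj; first by rewrite (ord1 j) (ord1 j').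
by rewrite !cofaceE leq_bump2.
Qed.

Lemma coface_coface k i :
  coface k.+2 0 \o coface k.+1 i = coface k.+2 i.+1 \o coface k.+1 0.
Proof.
apply: funext => j; apply: ord_inj => /=.
by rewrite !cofaceE /bump !leq0n !add1n ltnS addnS.
Qed.

Section NFGamma.
Variables (C D : addcat) (F : functor C D).

Section Objects.
Variable X : bcomplex C.

Lemma coface_indep k i b :
  gamma_act (bd X b) (coface k i.+1) = gamma_act (bd X false) (coface k i.+1).
Proof.
apply: eq_bigr => eta _; apply: eq_bigr => theta _; congr (_ \oc _ \oc _).
rewrite /gamma_entry; case: ifP => // _; case: ifP => // /forallP/(_ ord0)/eqP.
have -> : coface k i.+1 ord0 = ord0.
  by apply: ord_inj; rewrite inordK /bump ?ltn0 ?add0n.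
by rewrite epi0.
Qed.

Definition nfg_face b k i :
    hom (F (gamma X k)) (F (gamma X k.-1)) :=
  fmap F (gamma_act (bd X b) (coface k i)).

(* The degree k part of N F Gamma X is the intersection of the kernels of the
   faces d_1, ..., d_k of F (Gamma X). By [coface_indep] these do not involve
   the differential, so that N F Gamma (X, d) and N F Gamma (X, \tilde d) have
   the same underlying graded object. *)
Definition nfg_ob k : D := ker (fun i : 'I_k => nfg_face false k i.+1).

Definition nfg_in k : hom (nfg_ob k) (F (gamma X k)) := kin _.

Lemma nfg_in0 b k i : (i < k)%N -> nfg_face b k i.+1 \oc nfg_in k = 0.
Proof.
by move=> ik; rewrite /nfg_face coface_indep; apply: (kinP _ (Ordinal ik)).
Qed.

Lemma nfg_face_face b k i : (i < k)%N ->
  nfg_face b k i.+1 \oc nfg_face b k.+1 0 = nfg_face b k 0 \oc nfg_face b k.+1 i.+2.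
Proof.
case: k => // k ik; rewrite /nfg_face -!fmapM; congr (fmap F _).
rewrite !gamma_actM; try exact: bdd; try exact: (@coface_mono _.+1).
by rewrite coface_coface.
Qed.

Fact nfg_d_proof b k (i : 'I_k) :
  nfg_face false k i.+1 \oc (nfg_face b k.+1 0 \oc nfg_in k.+1) = 0.
Proof.
have -> : nfg_face false k i.+1 = nfg_face b k i.+1 by rewrite /nfg_face coface_indep.
by rewrite compA nfg_face_face // -compA nfg_in0 ?compm0 // ltnS ltn_ord.
Qed.

Definition nfg_d b k : hom (nfg_ob k.+1) (nfg_ob k) := klift _ (@nfg_d_proof b k).

Lemma nfg_inE b k : nfg_in k \oc nfg_d b k = nfg_face b k.+1 0 \oc nfg_in k.+1.
Proof. exact: klift_kin. Qed.

Fact nfg_dd b k : nfg_d b k \oc nfg_d b k.+1 = 0.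
Proof.
apply: kin_inj; rewrite compA nfg_inE -compA nfg_inE compA compm0.
have -> : nfg_face b k.+1 0 \oc nfg_face b k.+2 0 =
          nfg_face b k.+1 0 \oc nfg_face b k.+2 1.
  rewrite /nfg_face -!fmapM; congr (fmap F _).
  rewrite !gamma_actM; try exact: bdd; try exact: (@coface_mono _.+1).
  by rewrite coface_coface.
by rewrite -compA nfg_in0 ?compm0.
Qed.

Definition nfg : bcomplex D := BComplex nfg_dd.

End Objects.

Section Morphisms.
Variables (X Y : bcomplex C) (f : bmor X Y).

Definition gamma_map k : hom (gamma X k) (gamma Y k) :=
  \sum_eta (inj (fun t : epis k => Y (tag t)) eta \oc f (tag eta)
              \oc proj (fun t : epis k => X (tag t)) eta).

Lemma gamma_map_inj k (eta : epis k) :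
  gamma_map k \oc inj (fun t : epis k => X (tag t)) eta =
  inj (fun t : epis k => Y (tag t)) eta \oc f (tag eta).
Proof.
rewrite /gamma_map sum_comp (bigD1 eta) //= -(compA _ (proj _ _)) proj_inj comp1r.
rewrite big1 ?addr0 // => t te.
by rewrite -(compA _ (proj _ _)) proj_injN ?compm0 // eq_sym.
Qed.

Lemma gamma_entry_nat b l k (alpha : 'I_l.+1 -> 'I_k.+1) (eta : epis k) (theta : epis l) :
  f (tag theta) \oc gamma_entry (bd X b) alpha eta theta =
  gamma_entry (bd Y b) alpha eta theta \oc f (tag eta).
Proof.
rewrite /gamma_entry; case: ifP => _.
  case: (tag eta) (tag theta) => /= p _ [/= q _].
  have [->|/eqP n] := eqVneq p q; first by rewrite !idmm comp1l comp1r.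
  by rewrite !idmE // compm0 comp0m.
case: ifP => _; last by rewrite compm0 comp0m.
case: (tag eta) (tag theta) => /= p _ [/= q _].
have [<-|/eqP n] := eqVneq q.+1 p; first by rewrite !dmm bmapP.
by rewrite !dmE // compm0 comp0m.
Qed.

Lemma gamma_map_act b l k (alpha : 'I_l.+1 -> 'I_k.+1) :
  gamma_map l \oc gamma_act (bd X b) alpha = gamma_act (bd Y b) alpha \oc gamma_map k.
Proof.
apply: dsum_ext => eta.
rewrite -!compA gamma_act_inj gamma_map_inj compA gamma_act_inj comp_sum sum_comp.
by apply: eq_bigr => t _; rewrite compA gamma_map_inj -!compA gamma_entry_nat.
Qed.

Lemma nfg_face_map b k i : nfg_face Y b k i \oc fmap F (gamma_map k) =
  fmap F (gamma_map k.-1) \oc nfg_face X b k i.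
Proof. by rewrite -!fmapM gamma_map_act. Qed.

Fact nfg_map_proof k (i : 'I_k) :
  nfg_face Y false k i.+1 \oc (fmap F (gamma_map k) \oc nfg_in X k) = 0.
Proof. by rewrite compA nfg_face_map -compA nfg_in0 ?compm0. Qed.

Definition nfg_map k : hom (nfg_ob X k) (nfg_ob Y k) := klift _ (@nfg_map_proof k).

Lemma nfg_in_map k : nfg_in Y k \oc nfg_map k = fmap F (gamma_map k) \oc nfg_in X k.
Proof. exact: klift_kin. Qed.

Fact nfg_mapP b k : nfg_d Y b k \oc nfg_map k.+1 = nfg_map k \oc nfg_d X b k.
Proof.
apply: kin_inj; rewrite -!/(nfg_in _ _) !compA nfg_inE nfg_in_map -!compA.
by rewrite nfg_in_map nfg_inE !compA nfg_face_map.
Qed.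

Definition nfg_mor : bmor (nfg X) (nfg Y) := @BMor _ (nfg X) (nfg Y) nfg_map nfg_mapP.
End Morphisms.

Lemma gamma_map1 (X : BC C) k : gamma_map (idc X : bmor X X) k = idc (gamma X k).
Proof.
by apply: dsum_ext => eta; rewrite gamma_map_inj comp1r comp1l.
Qed.

Lemma gamma_mapM (X Y Z : BC C) (g : hom Y Z) (f : hom X Y) k :
  gamma_map (g \oc f : bmor X Z) k =
  gamma_map (g : bmor Y Z) k \oc gamma_map (f : bmor X Y) k.
Proof.
apply: dsum_ext => eta; rewrite -[RHS]compA !gamma_map_inj [RHS]compA.
by rewrite gamma_map_inj -[RHS]compA.
Qed.

Definition NFGamma : functor (BC C) (BC D).
Proof.
refine (@Functor (BC C) (BC D) nfg nfg_mor _ _).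
- move=> X; apply: bmor_ext => k; apply: kin_inj.
  by rewrite nfg_in_map gamma_map1 fmap1 comp1l comp1r.
- move=> X Y Z g f; apply: bmor_ext => k; apply: kin_inj.
  rewrite nfg_in_map gamma_mapM fmapM [RHS]compA nfg_in_map -compA.
  by rewrite -[RHS]compA nfg_in_map compA.
Defined.

End NFGamma.

(* The r-th exterior power of M: the R-module presented by the generators
   v_1 /\ ... /\ v_r subject to the multilinearity and alternation relations,
   i.e. formal R-linear combinations modulo the congruence [ext_eq]. *)
Section Exterior.
Variables (R : comPzRingType) (r : nat).

Section Object.
Variable M : lmodType R.

Inductive ext_term : Type :=
| EGen of ('I_r -> M)
| EZero
| EAdd of ext_term & ext_term
| EScale of R & ext_term.

Inductive ext_eq : ext_term -> ext_term -> Prop :=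
| ext_refl x : ext_eq x x
| ext_sym x y : ext_eq x y -> ext_eq y x
| ext_trans x y z : ext_eq x y -> ext_eq y z -> ext_eq x z
| ext_congr_add x x' y y' :
    ext_eq x x' -> ext_eq y y' -> ext_eq (EAdd x y) (EAdd x' y')
| ext_congr_scale a x x' : ext_eq x x' -> ext_eq (EScale a x) (EScale a x')
| ext_addA x y z : ext_eq (EAdd x (EAdd y z)) (EAdd (EAdd x y) z)
| ext_addC x y : ext_eq (EAdd x y) (EAdd y x)
| ext_add0 x : ext_eq (EAdd EZero x) x
| ext_addN x : ext_eq (EAdd (EScale (-1) x) x) EZero
| ext_scaleA a b x : ext_eq (EScale a (EScale b x)) (EScale (a * b) x)
| ext_scale1 x : ext_eq (EScale 1 x) x
| ext_scaleDr a x y :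
    ext_eq (EScale a (EAdd x y)) (EAdd (EScale a x) (EScale a y))
| ext_scaleDl a b x :
    ext_eq (EScale (a + b) x) (EAdd (EScale a x) (EScale b x))
| ext_multilinear (i : 'I_r) (a : R) (u v w : 'I_r -> M) :
    (forall j, j != i -> u j = v j /\ w j = v j) ->
    w i = a *: u i + v i ->
    ext_eq (EGen w) (EAdd (EScale a (EGen u)) (EGen v))
| ext_alternating (i j : 'I_r) (v : 'I_r -> M) :
    i != j -> v i = v j -> ext_eq (EGen v) EZero.

Record ext : Type := Ext {
  ext_class : ext_term -> Prop;
  ext_classP : exists t, ext_class = ext_eq t }.

Definition ext_pi (t : ext_term) : ext := Ext (ex_intro _ t erefl).
Definition ext_repr (x : ext) : ext_term := projT1 (cid (ext_classP x)).

Lemma ext_piP s t : ext_pi s = ext_pi t <-> ext_eq s t.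
Proof.
split=> [[->]|st]; first exact: ext_refl.
have e : ext_eq s = ext_eq t.
  apply: funext => u; apply: propext; split=> h.
    by apply: ext_trans h; apply: ext_sym.
  exact: ext_trans h.
rewrite /ext_pi; move: (ex_intro _ s _) (ex_intro _ t _); rewrite e => p q.
by congr Ext; apply: Prop_irrelevance.
Qed.

Lemma ext_reprK x : ext_pi (ext_repr x) = x.
Proof.
rewrite /ext_repr; case: cid => t /=; case: x => c p /= e; subst c.
by congr Ext; apply: Prop_irrelevance.
Qed.

Lemma ext_repr_pi t : ext_eq (ext_repr (ext_pi t)) t.
Proof. by apply/ext_piP; rewrite ext_reprK. Qed.

HB.instance Definition _ := gen_eqMixin ext.
HB.instance Definition _ := gen_choiceMixin ext.

Definition ext_add (x y : ext) := ext_pi (EAdd (ext_repr x) (ext_repr y)).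
Definition ext_scale (a : R) (x : ext) := ext_pi (EScale a (ext_repr x)).

Lemma ext_pi_add s t : ext_pi (EAdd s t) = ext_add (ext_pi s) (ext_pi t).
Proof. by apply/ext_piP/ext_congr_add; apply/ext_sym/ext_repr_pi. Qed.

Lemma ext_pi_scale a t : ext_pi (EScale a t) = ext_scale a (ext_pi t).
Proof. by apply/ext_piP/ext_congr_scale/ext_sym/ext_repr_pi. Qed.

Fact ext_add_A : associative ext_add.
Proof.
move=> x y z; rewrite -[x]ext_reprK -[y]ext_reprK -[z]ext_reprK -!ext_pi_add.
exact/ext_piP/ext_addA.
Qed.
Fact ext_add_C : commutative ext_add.
Proof.
move=> x y; rewrite -[x]ext_reprK -[y]ext_reprK -!ext_pi_add.
exact/ext_piP/ext_addC.
Qed.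
Fact ext_add_0 : left_id (ext_pi EZero) ext_add.
Proof. by move=> x; rewrite -[x]ext_reprK -!ext_pi_add; apply/ext_piP/ext_add0. Qed.
Fact ext_add_N : left_inverse (ext_pi EZero) (ext_scale (-1)) ext_add.
Proof.
by move=> x; rewrite -[x]ext_reprK -ext_pi_scale -ext_pi_add; apply/ext_piP/ext_addN.
Qed.

HB.instance Definition _ :=
  GRing.isZmodule.Build ext ext_add_A ext_add_C ext_add_0 ext_add_N.

Lemma ext_piD s t : ext_pi (EAdd s t) = ext_pi s + ext_pi t.
Proof. exact: ext_pi_add. Qed.

Fact ext_scale_A a b x : ext_scale a (ext_scale b x) = ext_scale (a * b) x.
Proof. by rewrite -[x]ext_reprK -!ext_pi_scale; apply/ext_piP/ext_scaleA. Qed.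
Fact ext_scale_1 : left_id 1 ext_scale.
Proof. by move=> x; rewrite -[x]ext_reprK -!ext_pi_scale; apply/ext_piP/ext_scale1. Qed.
Fact ext_scale_Dr : right_distributive ext_scale +%R.
Proof.
move=> a x y; rewrite -[x]ext_reprK -[y]ext_reprK -ext_piD -!ext_pi_scale -ext_piD.
exact/ext_piP/ext_scaleDr.
Qed.
Fact ext_scale_Dl x : {morph ext_scale^~ x : a b / a + b}.
Proof.
by move=> a b; rewrite -[x]ext_reprK -!ext_pi_scale -ext_piD; apply/ext_piP/ext_scaleDl.
Qed.

HB.instance Definition _ := GRing.Zmodule_isLmodule.Build R ext
  ext_scale_A ext_scale_1 ext_scale_Dr ext_scale_Dl.

Lemma ext_piZ a t : ext_pi (EScale a t) = a *: ext_pi t.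
Proof. exact: ext_pi_scale. Qed.

Definition wedge (v : 'I_r -> M) : ext := ext_pi (EGen v).

End Object.

Section Map.
Variables (M N : lmodType R) (f : {linear M -> N}).

Fixpoint ext_term_map (t : ext_term M) : ext_term N :=
  match t with
  | EGen v => EGen (f \o v)
  | EZero => EZero N
  | EAdd x y => EAdd (ext_term_map x) (ext_term_map y)
  | EScale a x => EScale a (ext_term_map x)
  end.

Lemma ext_term_map_eq s t : ext_eq s t -> ext_eq (ext_term_map s) (ext_term_map t).
Proof.
elim=> //=; try by [constructor | move=> *; constructor].
- by move=> x y z _ xy _; apply: ext_trans.
- move=> i a u v w uvw wi; apply: (ext_multilinear (i := i)) => [j ji|] /=.
    by have [-> ->] := uvw j ji.
  by rewrite wi linearP.
- by move=> i j v ij vij; apply: ext_alternating ij _ => /=; rewrite vij.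
Qed.

Definition ext_map_fun (x : ext M) : ext N := ext_pi (ext_term_map (ext_repr x)).

Lemma ext_map_pi t : ext_map_fun (ext_pi t) = ext_pi (ext_term_map t).
Proof. by apply/ext_piP/ext_term_map_eq/ext_repr_pi. Qed.

Fact ext_map_linear : linear ext_map_fun.
Proof.
move=> a x y; rewrite -[x]ext_reprK -[y]ext_reprK -ext_piZ -ext_piD !ext_map_pi.
by rewrite /= ext_piD ext_piZ.
Qed.

HB.instance Definition _ :=
  GRing.isLinear.Build R (ext M) (ext N) _ ext_map_fun ext_map_linear.
Definition ext_map : {linear ext M -> ext N} := ext_map_fun.

Lemma ext_map_wedge (v : 'I_r -> M) : ext_map (wedge v) = wedge (f \o v).
Proof. exact: ext_map_pi. Qed.
End Map.

Definition Lambda : functor (Mod R) (Mod R).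
Proof.
refine (@Functor (Mod R) (Mod R) (fun M => ext M) ext_map _ _).
- move=> M; apply: linear_ext => x; rewrite -[x]ext_reprK /= ext_map_pi.
  by congr ext_pi; elim: (ext_repr x) => //= [s -> t ->|a t ->].
- move=> L M N g f; apply: linear_ext => x; rewrite -[x]ext_reprK /= !ext_map_pi.
  by congr ext_pi; elim: (ext_repr x) => //= [s -> t ->|a t ->].
Defined.

End Exterior.

Section Multicomplexes.
Variable R : comPzRingType.

Definition finitely_generated (M : lmodType R) : Prop :=
  exists (n : nat) (e : 'I_n -> M),
    forall x : M, exists a : 'I_n -> R, x = \sum_i a i *: e i.

Definition projective (M : lmodType R) : Prop :=
  forall (A B : lmodType R) (g : {linear A -> B}) (f : {linear M -> B}),
    (forall b : B, exists a : A, g a = b) ->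
    exists h : {linear M -> A}, forall x : M, g (h x) = f x.

Definition fg_projective (M : lmodType R) : Prop :=
  finitely_generated M /\ projective M.

(* Binary multicomplexes of arbitrary R-modules. The last direction is the
   outermost one. *)
Fixpoint Multi (n : nat) : addcat :=
  match n with 0 => Mod R | m.+1 => BC (Multi m) end.

Definition finite_support (C : addcat) (X : nat -> C) : Prop :=
  exists N : nat, forall k : nat, (N <= k)%N -> is_zero (X k).

(* Acyclicity in the exact category of the objects of C satisfying E: the
   differentials factor through objects Z k of E fitting into short exact
   sequences Z (k + 1) >-> X (k + 1) ->> Z k, and X 0 = Z 0. *)
Definition acyclic (C : addcat) (E : C -> Prop)
    (X : nat -> C) (d : forall k, hom (X k.+1) (X k)) : Prop :=
  exists (Z : nat -> C) (i : forall k, hom (Z k) (X k))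
         (p : forall k, hom (X k.+1) (Z k)),
    [/\ forall k, E (Z k), is_iso (i 0%N),
        forall k, ses (i k.+1) (p k) & forall k, d k = i k \oc p k].

(* The objects of the exact category B^n(R), as a full subcategory of Multi n. *)
Fixpoint inB (n : nat) : Multi n -> Prop :=
  match n return Multi n -> Prop with
  | 0 => fg_projective
  | m.+1 => fun X : bcomplex (Multi m) =>
      [/\ forall k, inB (X k), finite_support X
        & forall b, acyclic (@inB m) (bd X b)]
  end.

(* d^i = \tilde d^i, for i < n (directions are numbered from 0). *)
Fixpoint diagonal_in (i n : nat) : Multi n -> Prop :=
  match n return Multi n -> Prop with
  | 0 => fun=> False
  | m.+1 => fun X : bcomplex (Multi m) =>
      if i == m then forall k, bd X false k = bd X true k
      else forall k, diagonal_in i (X k)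
  end.

Definition diagonal (n : nat) (X : Multi n) : Prop :=
  exists2 i, (i < n)%N & diagonal_in i X.

(* \Lambda^r_n, on all binary multicomplexes of modules. That it preserves
   B^n(R) is part of [is_lambda] below. *)
Fixpoint LambdaB (r n : nat) : functor (Multi n) (Multi n) :=
  match n return functor (Multi n) (Multi n) with
  | 0 => Lambda R r
  | m.+1 => NFGamma (LambdaB r m)
  end.

End Multicomplexes.

(* The groups K_n(R) are generated by modules, so their carriers live in a
   larger universe than the carriers of modules. As the latter are zmodTypes,
   these groups cannot be zmodTypes. *)
Record abgroup := AbGroup {
  ab_car :> Type;
  ab0 : ab_car;
  abopp : ab_car -> ab_car;
  abadd : ab_car -> ab_car -> ab_car;
  abaddA : associative abadd;
  abaddC : commutative abadd;
  abadd0 : left_id ab0 abadd;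
  abaddN : left_inverse ab0 abopp abadd }.

Record abhom (A B : abgroup) := AbHom {
  abfun :> A -> B;
  abfunD : forall x y, abfun (abadd x y) = abadd (abfun x) (abfun y) }.

Definition abimage (A B : abgroup) (f : abhom A B) (y : B) : Prop :=
  exists x : A, f x = y.

Section Presentation.
Variable G : Type.

Inductive ab_term : Type :=
| AGen of G
| AZero
| AOpp of ab_term
| AAdd of ab_term & ab_term.

Variable rel : ab_term -> ab_term -> Prop.

(* The smallest congruence containing rel whose quotient is an abelian group *)
Inductive ab_eq : ab_term -> ab_term -> Prop :=
| ab_rel x y : rel x y -> ab_eq x y
| ab_refl x : ab_eq x x
| ab_sym x y : ab_eq x y -> ab_eq y x
| ab_trans x y z : ab_eq x y -> ab_eq y z -> ab_eq x z
| ab_congr_opp x x' : ab_eq x x' -> ab_eq (AOpp x) (AOpp x')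
| ab_congr_add x x' y y' :
    ab_eq x x' -> ab_eq y y' -> ab_eq (AAdd x y) (AAdd x' y')
| ab_addA x y z : ab_eq (AAdd x (AAdd y z)) (AAdd (AAdd x y) z)
| ab_addC x y : ab_eq (AAdd x y) (AAdd y x)
| ab_add0 x : ab_eq (AAdd AZero x) x
| ab_addN x : ab_eq (AAdd (AOpp x) x) AZero.

Record pres : Type := Pres {
  pres_class : ab_term -> Prop;
  pres_classP : exists t, pres_class = ab_eq t }.

Definition pres_pi (t : ab_term) : pres := Pres (ex_intro _ t erefl).
Definition pres_repr (x : pres) : ab_term := projT1 (cid (pres_classP x)).

Lemma pres_piP s t : pres_pi s = pres_pi t <-> ab_eq s t.
Proof.
split=> [[->]|st]; first exact: ab_refl.
have e : ab_eq s = ab_eq t.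
  apply: funext => u; apply: propext; split=> h.
    by apply: ab_trans h; apply: ab_sym.
  exact: ab_trans h.
rewrite /pres_pi; move: (ex_intro _ s _) (ex_intro _ t _); rewrite e => p q.
by congr Pres; apply: Prop_irrelevance.
Qed.

Lemma pres_reprK x : pres_pi (pres_repr x) = x.
Proof.
rewrite /pres_repr; case: cid => t /=; case: x => c p /= e; subst c.
by congr Pres; apply: Prop_irrelevance.
Qed.

Lemma pres_repr_pi t : ab_eq (pres_repr (pres_pi t)) t.
Proof. by apply/pres_piP; rewrite pres_reprK. Qed.

Definition pres_opp (x : pres) := pres_pi (AOpp (pres_repr x)).
Definition pres_add (x y : pres) := pres_pi (AAdd (pres_repr x) (pres_repr y)).

Lemma pres_pi_opp t : pres_pi (AOpp t) = pres_opp (pres_pi t).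
Proof. by apply/pres_piP/ab_congr_opp/ab_sym/pres_repr_pi. Qed.

Lemma pres_pi_add s t : pres_pi (AAdd s t) = pres_add (pres_pi s) (pres_pi t).
Proof. by apply/pres_piP/ab_congr_add; apply/ab_sym/pres_repr_pi. Qed.

Definition presented : abgroup.
Proof.
refine (@AbGroup pres (pres_pi AZero) pres_opp pres_add _ _ _ _).
- move=> x y z; rewrite -[x]pres_reprK -[y]pres_reprK -[z]pres_reprK -!pres_pi_add.
  exact/pres_piP/ab_addA.
- move=> x y; rewrite -[x]pres_reprK -[y]pres_reprK -!pres_pi_add.
  exact/pres_piP/ab_addC.
- by move=> x; rewrite -[x]pres_reprK -pres_pi_add; apply/pres_piP/ab_add0.
- move=> x; rewrite -[x]pres_reprK -pres_pi_opp -pres_pi_add.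
  exact/pres_piP/ab_addN.
Defined.

Definition pres_gen (g : G) : presented := pres_pi (AGen g).

End Presentation.

Section AbHomTheory.
Variables A B : abgroup.

Lemma abaddI (C : abgroup) (x : C) : injective (abadd x).
Proof.
move=> y z e; rewrite -[y]abadd0 -[z]abadd0 -(abaddN x) -!abaddA.
by rewrite e.
Qed.

Lemma abhom0 (f : abhom A B) : f (ab0 A) = ab0 B.
Proof.
by apply: (@abaddI B (f (ab0 A))); rewrite -abfunD abadd0 abaddC abadd0.
Qed.

Lemma abhomN (f : abhom A B) x : f (abopp x) = abopp (f x).
Proof.
by apply: (@abaddI B (f x)); rewrite -abfunD !(abaddC _ (abopp _)) !abaddN abhom0.
Qed.

End AbHomTheory.

Lemma presented_hom_ext (G : Type) (rel : ab_term G -> ab_term G -> Prop)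
    (A : abgroup) (f g : abhom (presented rel) A) :
  (forall x : G, f (pres_gen rel x) = g (pres_gen rel x)) -> f =1 g.
Proof.
move=> fg x; rewrite -[x]pres_reprK; elim: (pres_repr x) => [y||t IH|s IHs t IHt].
- exact: fg.
- by rewrite (abhom0 f) (abhom0 g).
- by rewrite pres_pi_opp (abhomN f) (abhomN g) IH.
- by rewrite pres_pi_add (abfunD f) (abfunD g) IHs IHt.
Qed.

Section KGroups.
Variables (R : comPzRingType) (n : nat).

Definition Bob := {X : Multi R n | inB X}.

Inductive K_rel : ab_term Bob -> ab_term Bob -> Prop :=
| K_ses (X Y Z : Bob) (f : hom (sval X) (sval Y)) (g : hom (sval Y) (sval Z)) :
    ses f g -> K_rel (AGen Y) (AAdd (AGen X) (AGen Z))
| K_diagonal (X : Bob) : diagonal (sval X) -> K_rel (AGen X) (AZero Bob).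

Definition K : abgroup := presented K_rel.

Definition Kclass (X : Multi R n) (BX : inB X) : K := pres_gen K_rel (exist _ X BX).

End KGroups.

Section AutCat.
Variables (C : category) (n : nat).

Record auttuple := AutTuple {
  aut_ob :> C;
  aut : 'I_n -> hom aut_ob aut_ob;
  aut_iso : forall i, is_iso (aut i);
  aut_comm : forall i j, aut i \oc aut j = aut j \oc aut i }.

Record autmor (S T : auttuple) := AutMor {
  aut_map :> hom S T;
  aut_mapP : forall i, aut_map \oc aut S i = aut T i \oc aut_map }.

Lemma autmor_ext S T (f g : autmor S T) : aut_map f = aut_map g -> f = g.
Proof.
case: f => f pf; case: g => g pg /= fg; subst g.
by congr AutMor; apply: Prop_irrelevance.
Qed.

Fact aut_id_proof (T : auttuple) i : idc T \oc aut T i = aut T i \oc idc T.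
Proof. by rewrite comp1l comp1r. Qed.

Fact aut_comp_proof (S T U : auttuple) (g : autmor T U) (f : autmor S T) i :
  (aut_map g \oc aut_map f) \oc aut S i = aut U i \oc (aut_map g \oc aut_map f).
Proof. by rewrite -compA aut_mapP compA aut_mapP compA. Qed.

Definition AutCat : category.
Proof.
refine (@Category auttuple autmor (fun T => AutMor (aut_id_proof T))
  (fun S T U g f => AutMor (aut_comp_proof g f)) _ _ _).
- by move=> *; apply: autmor_ext; apply: compA.
- by move=> *; apply: autmor_ext; apply: comp1l.
- by move=> *; apply: autmor_ext; apply: comp1r.
Defined.

End AutCat.

Section Truncation.
Variables (C : category) (n : nat).

Definition aut_trunc (T : auttuple C n.+1) : auttuple C n :=
  @AutTuple C n T (fun i => aut T (widen_ord (leqnSn n) i))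
    (fun i => aut_iso T _) (fun i j => aut_comm T _ _).

Definition aut_trunc_map (S T : auttuple C n.+1) (f : autmor S T) :
    autmor (aut_trunc S) (aut_trunc T) :=
  @AutMor C n (aut_trunc S) (aut_trunc T) f (fun i => aut_mapP f _).

Definition aut_last (T : auttuple C n.+1) : autmor (aut_trunc T) (aut_trunc T) :=
  @AutMor C n (aut_trunc T) (aut_trunc T) (aut T ord_max) (fun i => aut_comm T _ _).

End Truncation.

(* two_term a : the binary complex X -> X in degrees 1 and 0, d = a, \tilde d = 1.
   Iterating it gives the multicomplex [P; A_1, ..., A_n], called cube below. *)
Section TwoTerm.
Variable C : addcat.

Definition two_ob (X : C) (k : nat) : C :=
  match k with 0 | 1 => X | _ => zob C end.

Definition two_map (X Y : C) (f : hom X Y) k : hom (two_ob X k) (two_ob Y k) :=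
  match k with 0 | 1 => f | _ => 0 end.

Definition two_d (X : C) (a : hom X X) (b : bool) k :
    hom (two_ob X k.+1) (two_ob X k) :=
  match k with 0 => if b then idc X else a | _ => 0 end.

Fact two_dd (X : C) (a : hom X X) b k : two_d a b k \oc two_d a b k.+1 = 0.
Proof. by rewrite compm0. Qed.

Definition two_term (X : C) (a : hom X X) : bcomplex C := BComplex (two_dd a).

Fact two_mapP (X Y : C) (a : hom X X) (a' : hom Y Y) (f : hom X Y) :
  f \oc a = a' \oc f ->
  forall b k, two_d a' b k \oc two_map f k.+1 = two_map f k \oc two_d a b k.
Proof.
move=> fa b [|k] /=; last by rewrite comp0m compm0.
by case: b; rewrite ?comp1l ?comp1r.
Qed.

Definition two_mor (X Y : C) (a : hom X X) (a' : hom Y Y) (f : hom X Y)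
    (fa : f \oc a = a' \oc f) : bmor (two_term a) (two_term a') :=
  @BMor C (two_term a) (two_term a') (two_map f) (two_mapP fa).

End TwoTerm.

Section Cube.
Variable R : comPzRingType.

Section Step.
Variables (n : nat) (F : functor (AutCat (Mod R) n) (Multi R n)).

Definition cube_ob (T : AutCat (Mod R) n.+1) : Multi R n.+1 :=
  two_term (@fmap _ _ F (aut_trunc T) (aut_trunc T) (aut_last T)).

Fact cube_map_proof (S T : AutCat (Mod R) n.+1) (f : hom S T) :
  @fmap _ _ F (aut_trunc S) (aut_trunc T) (aut_trunc_map f) \oc
    @fmap _ _ F (aut_trunc S) (aut_trunc S) (aut_last S) =
  @fmap _ _ F (aut_trunc T) (aut_trunc T) (aut_last T) \oc
    @fmap _ _ F (aut_trunc S) (aut_trunc T) (aut_trunc_map f).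
Proof. by rewrite -!fmapM; congr fmap; apply: autmor_ext;
  apply: (aut_mapP (f : autmor S T) ord_max). Qed.

Definition cube_map (S T : AutCat (Mod R) n.+1) (f : hom S T) :
  hom (cube_ob S) (cube_ob T) := two_mor (cube_map_proof f).

Definition cube_step : functor (AutCat (Mod R) n.+1) (Multi R n.+1).
Proof.
refine (@Functor (AutCat (Mod R) n.+1) (Multi R n.+1) cube_ob cube_map _ _).
- move=> T; apply: bmor_ext => k.
  have e : aut_trunc_map (idc T) = idc (aut_trunc T : AutCat (Mod R) n).
    exact: autmor_ext.
  case: k => [|[|k]] /=; try by rewrite e fmap1.
  by have := zob0 (Multi R n).
- move=> S T U g f; apply: bmor_ext => k.
  have e : aut_trunc_map (g \oc f) =
      (aut_trunc_map g : @hom (AutCat (Mod R) n) (aut_trunc T) (aut_trunc U)) \oc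
      (aut_trunc_map f : @hom (AutCat (Mod R) n) (aut_trunc S) (aut_trunc T)).
    exact: autmor_ext.
  case: k => [|[|k]] /=; try by rewrite e fmapM.
  by rewrite compm0.
Defined.

End Step.

Definition cube0 : functor (AutCat (Mod R) 0) (Mod R) :=
  @Functor (AutCat (Mod R) 0) (Mod R) (fun T => aut_ob T) (fun S T f => aut_map f)
    (fun T => erefl) (fun S T U g f => erefl).

Fixpoint cube (n : nat) : functor (AutCat (Mod R) n) (Multi R n) :=
  match n return functor (AutCat (Mod R) n) (Multi R n) with
  | 0 => cube0
  | m.+1 => cube_step (cube m)
  end.

End Cube.

Section ZeroObjects.
Variable C : addcat.

Lemma zero_from (X Y : C) (f : hom X Y) : is_zero X -> f = 0.
Proof. by move=> X0; rewrite -[f]comp1r X0 compm0. Qed.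

Lemma zero_to (X Y : C) (f : hom X Y) : is_zero Y -> f = 0.
Proof. by move=> Y0; rewrite -[f]comp1l Y0 comp0m. Qed.

Lemma zero_iso (X Y : C) (f : hom X Y) : is_zero X -> is_zero Y -> is_iso f.
Proof. by move=> X0 Y0; exists 0; rewrite comp0m compm0 X0 Y0. Qed.

End ZeroObjects.

Lemma id_iso (C : category) (X : C) : is_iso (idc X).
Proof. by exists (idc X); rewrite comp1l. Qed.

Lemma fmap_iso (C D : category) (F : functor C D) (X Y : C) (f : hom X Y) :
  is_iso f -> is_iso (fmap F f).
Proof. by case=> g [gf fg]; exists (fmap F g); rewrite -!fmapM gf fg !fmap1. Qed.

Lemma inv_comm (C : category) (X : C) (a b g : hom X X) :
  g \oc a = idc X -> a \oc g = idc X -> b \oc a = a \oc b -> g \oc b = b \oc g.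
Proof.
move=> ga ag ba; rewrite -[LHS]comp1r -ag [LHS]compA -(compA g b a) ba.
by rewrite (compA g a b) ga comp1l.
Qed.

Section CubeInB.
Variable R : comPzRingType.

Lemma Multi_ses_iso n (X Y Z : Multi R n) (f : hom X Y) (g : hom Y Z) :
  is_zero X -> is_iso g -> ses f g.
Proof.
elim: n X Y Z f g => [|n IH] X Y Z f g X0 [h [hg gh]] /=.
  have X0x (x : X : lmodType R) : x = 0.
    by have := congr1 (fun k : {linear X -> X} => k x) X0.
  have hgK (y : Y : lmodType R) : (h : {linear Z -> Y}) ((g : {linear Y -> Z}) y) = y.
    by have := congr1 (fun k : {linear Y -> Y} => k y) hg.
  split=> [x x' _|z|y]; first by rewrite (X0x x) (X0x x').
    exists ((h : {linear Z -> Y}) z).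
    by have := congr1 (fun k : {linear Z -> Z} => k z) gh.
  split=> [gy|[x <-]]; last first.
    by rewrite (X0x x) (linear0 (f : {linear X -> Y})) (linear0 (g : {linear Y -> Z})).
  exists 0; rewrite (linear0 (f : {linear X -> Y})) -(hgK y) gy.
  by rewrite (linear0 (h : {linear Z -> Y})).
move=> k; apply: IH.
  by have := congr1 (fun u : bmor X X => u k) X0.
exists ((h : bmor Z Y) k); split.
  by have := congr1 (fun u : bmor Y Y => u k) hg.
by have := congr1 (fun u : bmor Z Z => u k) gh.
Qed.

Lemma zero_inB n (X : Multi R n) : is_zero X -> inB X.
Proof.
elim: n X => [|n IH] X X0 /=.
  have X0x (x : X : lmodType R) : x = 0.
    by have := congr1 (fun k : {linear X -> X} => k x) X0.
  split; first by exists 0%N, (fun=> 0) => x; exists (fun=> 0); rewrite big_ord0 (X0x x).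
  move=> A B g f _; exists 0 => x.
  by rewrite (X0x x) (linear0 f); apply: (linear0 g).
have X0k k : is_zero ((X : bcomplex _) k).
  by have := congr1 (fun u : bmor X X => u k) X0.
split=> [k||b]; first exact: IH.
  by exists 0%N.
exists (X : bcomplex _), (fun k => idc _), (bd X b); split.
- by move=> k; apply: IH.
- exact: id_iso.
- move=> k; rewrite [idc _]X0k; apply: Multi_ses_iso => //.
  exact: zero_iso.
- by move=> k; rewrite comp1l.
Qed.

Lemma two_term_inB n (X : Multi R n) (a : hom X X) :
  inB X -> is_iso a -> inB (two_term a : Multi R n.+1).
Proof.
move=> BX aI; have z := zob0 (Multi R n); split=> /=.
- by case=> [|[|k]] //=; apply: zero_inB.
- by exists 2%N => -[|[|k]].
move=> b.
exists (fun k => if k is 0 then X else zob (Multi R n)).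
exists (fun k => match k return hom (if k is 0 then X else zob _) (two_ob X k) with
                 | 0 => idc X | _ => 0 end).
exists (fun k => match k return hom (two_ob X k.+1) (if k is 0 then X else zob _) with
                 | 0 => two_d a b 0 | _ => 0 end).
split=> [[|k]||[|k]|[|k]] /=.
- by [].
- exact: zero_inB.
- exact: id_iso.
- by apply: Multi_ses_iso => //; case: b => //; apply: id_iso.
- by apply: Multi_ses_iso => //; apply: zero_iso.
- by rewrite comp1l.
- by rewrite compm0.
Qed.

Lemma cube_inB n (T : auttuple (mod_cat R) n) :
  fg_projective (aut_ob T) -> inB (cube R n T).
Proof.
elim: n T => [|n IH] T PT //=.
apply: two_term_inB; first exact: (IH (aut_trunc T)).
apply: fmap_iso; have [g [ga ag]] := aut_iso T ord_max.
have gP i : g \oc aut (aut_trunc T) i = aut (aut_trunc T) i \oc g.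
  exact: inv_comm ga ag (aut_comm T _ _).
exists (@AutMor _ _ (aut_trunc T) (aut_trunc T) g gP :
  @hom (AutCat (Mod R) n) (aut_trunc T) (aut_trunc T)).
by split; apply: autmor_ext.
Qed.

End CubeInB.

Section MilnorK.
Variables (R : comPzRingType) (n : nat).

Definition AutP := {T : auttuple (Mod R) n | fg_projective (aut_ob T)}.

Inductive KM_rel : ab_term AutP -> ab_term AutP -> Prop :=
| KM_iso (S T : AutP) (f : @hom (AutCat (Mod R) n) (sval S) (sval T)) :
    is_iso f -> KM_rel (AGen S) (AGen T)
| KM_ses (S T U : AutP)
    (f : autmor (sval S) (sval T)) (g : autmor (sval T) (sval U)) :
    ses (aut_map f) (aut_map g) -> KM_rel (AGen T) (AAdd (AGen S) (AGen U))
| KM_multilinear (P : Mod R) (PP : fg_projective P) (i : 'I_n)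
    (A A' A'' : 'I_n -> hom P P)
    (iA : forall j, is_iso (A j)) (cA : forall j k, A j \oc A k = A k \oc A j)
    (iA' : forall j, is_iso (A' j)) (cA' : forall j k, A' j \oc A' k = A' k \oc A' j)
    (iA'' : forall j, is_iso (A'' j))
    (cA'' : forall j k, A'' j \oc A'' k = A'' k \oc A'' j) :
    (forall j, j != i -> A' j = A j /\ A'' j = A j) -> A'' i = A i \oc A' i ->
    KM_rel (AGen (exist _ (AutTuple iA'' cA'') PP))
      (AAdd (AGen (exist _ (AutTuple iA cA) PP)) (AGen (exist _ (AutTuple iA' cA') PP)))
| KM_steinberg (T : AutP) (i j : 'I_n) :
    i != j -> aut (sval T) i + aut (sval T) j = idc (aut_ob (sval T)) ->
    KM_rel (AGen T) (AZero AutP).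

Definition KM : abgroup := presented KM_rel.

Definition KMclass (T : auttuple (Mod R) n) (PT : fg_projective (aut_ob T)) : KM :=
  pres_gen KM_rel (exist _ T PT).

(* The classes on which phi is prescribed generate the source, so that phi is
   unique ([is_phi_unique]); likewise for is_lambda below. *)
Definition is_phi (phi : abhom KM (K R n)) : Prop :=
  forall (T : auttuple (Mod R) n) (PT : fg_projective (aut_ob T)),
    phi (KMclass PT) = Kclass (cube_inB PT).

Definition is_lambda (r : nat) (lambda : abhom (K R n) (K R n)) : Prop :=
  forall (X : Multi R n) (BX : inB X),
    exists BY : inB (LambdaB R r n X), lambda (Kclass BX) = Kclass BY.

Lemma is_phi_unique (phi psi : abhom KM (K R n)) :
  is_phi phi -> is_phi psi -> phi =1 psi.
Proof.
by move=> p q; apply: presented_hom_ext => -[T PT]; rewrite [LHS]p [RHS]q.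
Qed.

Lemma is_lambda_unique r (lambda mu : abhom (K R n) (K R n)) :
  is_lambda r lambda -> is_lambda r mu -> lambda =1 mu.
Proof.
move=> p q; apply: presented_hom_ext => -[X BX].
have [BY e] := p X BX; have [BY' e'] := q X BX.
by rewrite [LHS]e [RHS]e' (Prop_irrelevance BY BY').
Qed.

End MilnorK.

(* Main.v *)
From Pilot Require Import Defs.
From mathcomp Require Import all_boot all_algebra.
From mathcomp Require Import boolp.
Import Pilot.Defs.

Set Implicit Arguments.
Unset Strict Implicit.
Unset Printing Implicit Defensive.
Import GRing.Theory.
Local Open Scope ring_scope.

(* Since phi and lambda are additive, it suffices to treat the multicomplex
   Y = \Lambda^r_n [P; A_1, ..., A_n]. In every direction i its differentials are
   conjugate by a graded automorphism theta^i: d = theta^-1 \tilde d theta, because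
   (A_i, 1) is an isomorphism from the complex P -> P with differential A_i to the
   one with differential 1, and N F Gamma does not see the differential on the
   underlying graded objects. The theta^i commute with each other and with the
   differentials in the other directions.

   For a binary complex Y with such a theta, consider the cone T of the pair
   (theta, id), both being isomorphisms (Y, d) -> (Y, \tilde d) resp.
   (Y, \tilde d) -> (Y, \tilde d). On the one hand T is an extension of a shift of Y
   (up to sign) by the diagonal complex (Y, \tilde d, \tilde d); on the other hand T
   is filtered by its rows, which are shifts of the complexes Y_k -> Y_k with
   differentials theta_k and 1. Hence [Y] is the alternating sum of the latter.
   Iterating over all directions expresses [Y] by the classes
   [Y_k; theta^1_k, ..., theta^n_k] with Y_k a projective module. *)


(** * Conjugate differentials *)

(* An additional structure on the objects of C, together with a class of
   structure preserving morphisms, that passes to direct sums and kernels. *)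
Record structcat (C : addcat) := Structcat {
  str : C -> Type;
  smor : forall X Y : C, str X -> str Y -> hom X Y -> Prop;
  smor1 : forall X (s : str X), smor s s (idc X);
  smorM : forall X Y Z (s : str X) (t : str Y) (u : str Z) (g : hom Y Z) (f : hom X Y),
    smor t u g -> smor s t f -> smor s u (g \oc f);
  smor0 : forall X Y (s : str X) (t : str Y), smor s t 0;
  smorD : forall X Y (s : str X) (t : str Y) (f g : hom X Y),
    smor s t f -> smor s t g -> smor s t (f + g);
  sdsum : forall (I : finType) (X : I -> C), (forall i, str (X i)) -> str (dsum X);
  smor_inj : forall (I : finType) (X : I -> C) (s : forall i, str (X i)) i,
    smor (s i) (sdsum s) (inj X i);
  smor_proj : forall (I : finType) (X : I -> C) (s : forall i, str (X i)) i,
    smor (sdsum s) (s i) (proj X i);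
  sker : forall (I : finType) (X : C) (Y : I -> C) (f : forall i, hom X (Y i))
    (s : str X) (t : forall i, str (Y i)),
    (forall i, smor s (t i) (f i)) -> str (ker f);
  smor_kin : forall (I : finType) (X : C) (Y : I -> C) (f : forall i, hom X (Y i))
    (s : str X) (t : forall i, str (Y i)) (sf : forall i, smor s (t i) (f i)),
    smor (sker sf) s (kin f);
  smor_klift : forall (I : finType) (X : C) (Y : I -> C) (f : forall i, hom X (Y i))
    (s : str X) (t : forall i, str (Y i)) (sf : forall i, smor s (t i) (f i))
    (Z : C) (u : str Z) (g : hom Z X) (fg0 : forall i, f i \oc g = 0),
    smor u s g -> smor u (sker sf) (klift g fg0) }.

Arguments smor {C _ X Y}.

Definition zob_str (C : addcat) (S : structcat C) : str S (zob C) :=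
  @sdsum C S void (fun v => match v with end) (fun v => match v with end).

Lemma smor_sum (C : addcat) (D : structcat C) (X Y : C) (s : str D X) (t : str D Y)
    (I : Type) (r : seq I) (f : I -> hom X Y) :
  (forall i, smor s t (f i)) -> smor s t (\sum_(i <- r) f i).
Proof.
move=> sf; elim: r => [|i r IH]; first by rewrite big_nil; apply: smor0.
by rewrite big_cons; apply: smorD.
Qed.

Section TwistedComplexes.
Variables (C : addcat) (D : structcat C).

(* The tw k conjugate d into \tilde d; they do not form a morphism of binary
   complexes. *)
Record twisting (X : bcomplex C) := Twisting {
  tw_str : forall k, str D (X k);
  tw : forall k, hom (X k) (X k);
  twV : forall k, hom (X k) (X k);
  twVK : forall k, tw k \oc twV k = idc (X k);
  twK : forall k, twV k \oc tw k = idc (X k);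
  tw_smor : forall k, smor (tw_str k) (tw_str k) (tw k);
  twV_smor : forall k, smor (tw_str k) (tw_str k) (twV k);
  tw_d : forall k, bd X true k \oc tw k.+1 = tw k \oc bd X false k }.

Definition tw_mor (X Y : bcomplex C) (s : twisting X) (t : twisting Y) (f : bmor X Y) :=
  forall k, smor (tw_str s k) (tw_str t k) (f k) /\ f k \oc tw s k = tw t k \oc f k.

(** Multiply the commutation relation by the inverses on both sides. In [tw_ker] this lets the
    inverses restrict to the kernel as well. *)
Lemma tw_morV (X Y : bcomplex C) (s : twisting X) (t : twisting Y) (f : bmor X Y) :
  tw_mor s t f -> forall k, f k \oc twV s k = twV t k \oc f k.
Proof.
move=> sf k; have [_ e] := sf k.
rewrite -[RHS]comp1r -(twVK s) -[RHS]compA (compA (f k)) e -(compA (tw t k)).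
by rewrite [RHS]compA twK comp1l.
Qed.

Section Dsum.
Variables (I : finType) (X : I -> bcomplex C).

Definition dsum_map k (f : forall i, hom (X i k) (X i k)) :
    hom (dsum (fun i => X i k)) (dsum (fun i => X i k)) :=
  \sum_i (inj (fun i => X i k) i \oc f i \oc proj (fun i => X i k) i).

Lemma dsum_map_inj k f i : @dsum_map k f \oc inj (fun i => X i k) i =
  inj (fun i => X i k) i \oc f i.
Proof.
rewrite /dsum_map sum_comp (bigD1 i) //= -compA proj_inj comp1r big1 ?addr0 //.
by move=> j ji; rewrite -compA proj_injN ?compm0 // eq_sym.
Qed.

Lemma proj_dsum_map k f i : proj (fun i => X i k) i \oc @dsum_map k f =
  f i \oc proj (fun i => X i k) i.
Proof.
rewrite /dsum_map comp_sum (bigD1 i) //= !compA proj_inj comp1l big1 ?addr0 //.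
by move=> j ji; rewrite !compA proj_injN // !comp0m.
Qed.

Variable s : forall i, twisting (X i).

Definition tw_dsum : twisting (bdsum X).
Proof.
refine (@Twisting (bdsum X) (fun k => sdsum (fun i => tw_str (s i) k))
  (fun k => dsum_map (fun i => tw (s i) k)) (fun k => dsum_map (fun i => twV (s i) k))
  _ _ _ _ _).
- by move=> k; apply: dsum_ext => i;
    rewrite -compA dsum_map_inj compA dsum_map_inj -compA twVK comp1r comp1l.
- by move=> k; apply: dsum_ext => i;
    rewrite -compA dsum_map_inj compA dsum_map_inj -compA twK comp1r comp1l.
- move=> k; apply: smor_sum => i.
  apply: smorM; last exact: (smor_proj (fun i => tw_str (s i) k)).
  by apply: smorM; [apply: (smor_inj (fun i => tw_str (s i) k)) | apply: tw_smor].
- move=> k; apply: smor_sum => i.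
  apply: smorM; last exact: (smor_proj (fun i => tw_str (s i) k)).
  by apply: smorM; [apply: (smor_inj (fun i => tw_str (s i) k)) | apply: twV_smor].
- move=> k; apply: dsum_ext => i; rewrite -!compA dsum_map_inj bdsum_d_inj.
  by rewrite !compA bdsum_d_inj dsum_map_inj -!compA tw_d.
Defined.

Lemma tw_mor_inj i : tw_mor (s i) tw_dsum (binj X i).
Proof.
move=> k; split; last by rewrite /= dsum_map_inj.
exact: (smor_inj (fun i => tw_str (s i) k)).
Qed.

Lemma tw_mor_proj i : tw_mor tw_dsum (s i) (bproj X i).
Proof.
move=> k; split; last by rewrite /= proj_dsum_map.
exact: (smor_proj (fun i => tw_str (s i) k)).
Qed.

End Dsum.

Section Kernel.
Variables (I : finType) (X : bcomplex C) (Y : I -> bcomplex C).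
Variables (f : forall i, bmor X (Y i)) (s : twisting X) (t : forall i, twisting (Y i)).
Hypothesis sf : forall i, tw_mor s (t i) (f i).

Fact tw_ker_proof k i : f i k \oc (tw s k \oc kin (fun i => f i k)) = 0.
Proof. by rewrite compA (proj2 (sf i k)) -compA (kinP (fun i => f i k)) compm0. Qed.

Fact twV_ker_proof k i : f i k \oc (twV s k \oc kin (fun i => f i k)) = 0.
Proof. by rewrite compA (tw_morV (sf i)) -compA (kinP (fun i => f i k)) compm0. Qed.

Definition tw_ker : twisting (bker f).
Proof.
refine (@Twisting (bker f) (fun k => sker (fun i => proj1 (sf i k)))
  (fun k => klift _ (@tw_ker_proof k)) (fun k => klift _ (@twV_ker_proof k)) _ _ _ _ _).
- by move=> k; apply: kin_inj; rewrite comp1r compA klift_kin -compA klift_kin compA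
    twVK comp1l.
- by move=> k; apply: kin_inj; rewrite comp1r compA klift_kin -compA klift_kin compA
    twK comp1l.
- by move=> k; apply: smor_klift; apply: smorM; [apply: tw_smor | apply: smor_kin].
- by move=> k; apply: smor_klift; apply: smorM; [apply: twV_smor | apply: smor_kin].
- move=> k; apply: kin_inj; rewrite [LHS]compA [RHS]compA (kin_bker_d f true k).
  rewrite -[LHS]compA !klift_kin -[RHS]compA (kin_bker_d f false k).
  by rewrite !compA tw_d.
Defined.

Lemma tw_mor_kin : tw_mor tw_ker s (bkin f).
Proof. by move=> k; split; [apply: smor_kin | rewrite /= klift_kin]. Qed.

Lemma tw_mor_klift (Z : bcomplex C) (u : twisting Z) (g : bmor Z X)
    (fg0 : forall i, (f i : @hom (BC C) _ _) \oc (g : @hom (BC C) _ _) = 0) :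
  tw_mor u s g -> tw_mor u tw_ker (bklift fg0).
Proof.
move=> sg k; have [sgk e] := sg k; split; first exact: smor_klift.
apply: kin_inj; rewrite compA klift_kin e [RHS]compA klift_kin.
by rewrite -compA klift_kin.
Qed.

End Kernel.

(** Each iteration adds the automorphism of one more direction. As [tw_smor] makes it preserve the
    structures already present, it commutes with the automorphisms of the inner directions. *)
Definition twisted : structcat (BC C).
Proof.
refine (@Structcat (BC C) twisting tw_mor _ _ _ _ tw_dsum tw_mor_inj tw_mor_proj
  tw_ker tw_mor_kin tw_mor_klift).
- by move=> X s k; split; [apply: smor1 | rewrite comp1l comp1r].
- move=> X Y Z s t u g f sg sf k; have [sgk ge] := sg k; have [sfk fe] := sf k.
  split; first exact: smorM sgk sfk.
  by rewrite -compA fe compA ge compA.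
- by move=> X Y s t k; split; [apply: smor0 | rewrite comp0m compm0].
- move=> X Y s t f g sf sg k; have [sgk ge] := sg k; have [sfk fe] := sf k.
  by split; [apply: smorD | rewrite addm_comp comp_addm fe ge].
Defined.

End TwistedComplexes.

(** A lift of [F] to objects with structure. The action on morphisms is part of it because the outer
    automorphisms, to which [F] is applied, must again preserve the inner structures. *)
Record sfunctor (C D : addcat) (S : structcat C) (T : structcat D) (F : functor C D) :=
  SFunctor {
    sob : forall X, str S X -> str T (F X);
    sfmap : forall X Y (s : str S X) (t : str S Y) (f : hom X Y),
      smor s t f -> smor (sob s) (sob t) (fmap F f) }.

(** * Conjugating automorphisms under N F Gamma *)

Section TwistedNFGamma.
Variables (C D : addcat) (S : structcat C) (T : structcat D) (F : functor C D).
Variable sF : sfunctor S T F.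

Lemma smor_idm (X : bcomplex C) (s : forall k, str S (X k)) p q :
  smor (s p) (s q) (idm X p q).
Proof.
have [<-|/eqP n] := eqVneq p q; first by rewrite idmm; apply: smor1.
by rewrite idmE //; apply: smor0.
Qed.

Section Gmap.
Variables (X : bcomplex C) (s : forall k, str S (X k)).

Definition gstr k : str S (gamma X k) := sdsum (fun eta : epis k => s (tag eta)).

(** A coface of positive index fixes 0, and all surjections send 0 to 0, so the matrix entries with
    a differential do not occur. What remains are identities and zeros, which preserve any
    structure. *)
Lemma smor_face k i :
  smor (gstr k) (gstr k.-1) (gamma_act (bd X false) (coface k i.+1)).
Proof.
apply: smor_sum => eta; apply: smor_sum => theta.
apply: smorM; last exact: (smor_proj (fun eta : epis k => s (tag eta))).
apply: smorM; first exact: (smor_inj (fun eta : epis k.-1 => s (tag eta))).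
rewrite /gamma_entry; case: ifP => _; first exact: smor_idm.
case: ifP => [/forallP/(_ ord0)/eqP|_]; last exact: smor0.
have -> : coface k i.+1 ord0 = ord0.
  by apply: ord_inj; rewrite inordK /bump ?ltn0 ?add0n.
by rewrite epi0.
Qed.
End Gmap.

(** A chain complex as a binary complex with equal differentials. The automorphism [tw] is a chain
    map from [d] to [\tilde d], so it becomes a morphism between two such complexes and [gamma_map]
    applies to it. *)
Definition pure (X : nat -> C) (d : forall k, hom (X k.+1) (X k))
    (dd : forall k, d k \oc d k.+1 = 0) : bcomplex C :=
  @BComplex C X (fun=> d) (fun _ k => dd k).

Lemma smor_gamma_map (X Y : bcomplex C) (s : forall k, str S (X k))
    (t : forall k, str S (Y k)) (f : bmor X Y) k :
  (forall k, smor (s k) (t k) (f k)) -> smor (gstr s k) (gstr t k) (gamma_map f k).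
Proof.
move=> sf; apply: smor_sum => eta.
apply: smorM; last exact: (smor_proj (fun eta : epis k => s (tag eta))).
by apply: smorM; first exact: (smor_inj (fun eta : epis k => t (tag eta))).
Qed.

Section Object.
Variables (X : bcomplex C) (s : twisting S X).

Let X0 := pure (bdd X false).
Let X1 := pure (bdd X true).
Definition gtw : bmor X0 X1 := @BMor C X0 X1 (tw s) (fun _ => tw_d s).

Fact gtwV_proof k : bd X false k \oc twV s k.+1 = twV s k \oc bd X true k.
Proof.
rewrite -[LHS]comp1l -(twK s) -!compA; congr (_ \oc _).
by rewrite compA -tw_d -compA twVK comp1r.
Qed.
Definition gtwV : bmor X1 X0 := @BMor C X1 X0 (twV s) (fun _ => gtwV_proof).

(** Naturality relates the face built from [d] to the one built from [\tilde d]; for positive index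
    the two coincide. *)
Fact face_gtw k i :
  nfg_face F X false k i.+1 \oc fmap F (gamma_map gtw k) =
  fmap F (gamma_map gtw k.-1) \oc nfg_face F X false k i.+1.
Proof.
rewrite -!fmapM; congr fmap.
by rewrite (gamma_map_act gtw false) -(coface_indep X k i true).
Qed.

Fact face_gtwV k i :
  nfg_face F X false k i.+1 \oc fmap F (gamma_map gtwV k) =
  fmap F (gamma_map gtwV k.-1) \oc nfg_face F X false k i.+1.
Proof.
rewrite -!fmapM; congr fmap; rewrite -{2}(coface_indep X k i true).
exact: esym (gamma_map_act gtwV false _).
Qed.

Fact ntw_proof k (i : 'I_k) : nfg_face F X false k i.+1 \oc
  (fmap F (gamma_map gtw k) \oc nfg_in F X k) = 0.
Proof. by rewrite compA face_gtw -compA nfg_in0 ?compm0. Qed.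

Fact ntwV_proof k (i : 'I_k) : nfg_face F X false k i.+1 \oc
  (fmap F (gamma_map gtwV k) \oc nfg_in F X k) = 0.
Proof. by rewrite compA face_gtwV -compA nfg_in0 ?compm0. Qed.

Definition ntw k : hom (nfg_ob F X k) (nfg_ob F X k) := klift _ (@ntw_proof k).
Definition ntwV k : hom (nfg_ob F X k) (nfg_ob F X k) := klift _ (@ntwV_proof k).

Lemma nfg_in_ntw k : nfg_in F X k \oc ntw k = fmap F (gamma_map gtw k) \oc nfg_in F X k.
Proof. exact: klift_kin. Qed.

Lemma nfg_in_ntwV k : nfg_in F X k \oc ntwV k = fmap F (gamma_map gtwV k) \oc nfg_in F X k.
Proof. exact: klift_kin. Qed.

(** N F Gamma is applied to the chain isomorphism from (X, d) to (X, \tilde d). Source and target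
    have the same underlying graded object, so the result is a graded automorphism of it. *)
Definition nfg_twisting : twisting T (nfg F X).
Proof.
refine (@Twisting D T (nfg F X)
  (fun k => sker (fun i : 'I_k => sfmap sF (smor_face (tw_str s) k i))) ntw ntwV _ _ _ _ _).
- move=> k; apply: kin_inj; rewrite comp1r compA nfg_in_ntw -compA nfg_in_ntwV compA -fmapM.
  rewrite (_ : _ \oc _ = idc (gamma X k)) ?fmap1 ?comp1l //; apply: dsum_ext => eta.
  rewrite -compA (gamma_map_inj gtwV) compA (gamma_map_inj gtw) -compA /= twVK.
  by rewrite comp1r comp1l.
- move=> k; apply: kin_inj; rewrite comp1r compA nfg_in_ntwV -compA nfg_in_ntw compA -fmapM.
  rewrite (_ : _ \oc _ = idc (gamma X k)) ?fmap1 ?comp1l //; apply: dsum_ext => eta.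
  rewrite -compA (gamma_map_inj gtw) compA (gamma_map_inj gtwV) -compA /= twK.
  by rewrite comp1r comp1l.
- move=> k; apply: smor_klift; apply: smorM; last exact: smor_kin.
  by apply/sfmap/(smor_gamma_map (X := X0) (Y := X1)) => j; exact: (tw_smor s j).
- move=> k; apply: smor_klift; apply: smorM; last exact: smor_kin.
  by apply/sfmap/(smor_gamma_map (X := X1) (Y := X0)) => j; exact: (twV_smor s j).
(* The differential is the face of index 0, which does depend on [d]; naturality of this face is
   exactly the conjugation of [d] into [\tilde d]. *)
- move=> k; apply: kin_inj; rewrite -!/(nfg_in _ _ _) !compA nfg_inE nfg_in_ntw.
  rewrite -!compA nfg_in_ntw nfg_inE !compA -!fmapM; congr (_ \oc _); congr fmap.
  exact: esym (gamma_map_act gtw false _).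
Defined.

End Object.

Lemma nfg_tw_mor (X Y : bcomplex C) (s : twisting S X) (t : twisting S Y) (f : bmor X Y) :
  tw_mor s t f -> tw_mor (nfg_twisting s) (nfg_twisting t) (nfg_mor F f).
Proof.
move=> sf k; split.
  apply: smor_klift; apply: smorM; last exact: smor_kin.
  by apply/sfmap/smor_gamma_map => j; case: (sf j).
apply: kin_inj; rewrite [LHS]compA nfg_in_map -compA nfg_in_ntw.
rewrite [RHS]compA nfg_in_ntw -compA nfg_in_map !compA -!fmapM; congr (_ \oc _).
congr fmap; apply: dsum_ext => eta; rewrite -compA (gamma_map_inj (gtw s)) compA.
rewrite (gamma_map_inj f) -!compA (gamma_map_inj f) [RHS]compA (gamma_map_inj (gtw t)).
by rewrite -compA /= (proj2 (sf _)).
Qed.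

Definition sNFGamma : sfunctor (twisted S) (twisted T) (NFGamma F) :=
  @SFunctor (BC C) (BC D) (twisted S) (twisted T) (NFGamma F) nfg_twisting nfg_tw_mor.

End TwistedNFGamma.

(** * Conjugating automorphisms of the cubes and of their exterior powers *)

Section TwistedMulti.
Variable R : comPzRingType.

Definition trivial_str (C : addcat) : structcat C :=
  @Structcat C (fun=> unit) (fun X Y _ _ _ => True)
    (fun _ _ => I) (fun _ _ _ _ _ _ _ _ _ _ => I) (fun _ _ _ _ => I)
    (fun _ _ _ _ _ _ _ _ => I) (fun _ _ _ => tt) (fun _ _ _ _ => I) (fun _ _ _ _ => I)
    (fun _ _ _ _ _ _ _ => tt) (fun _ _ _ _ _ _ _ => I)
    (fun _ _ _ _ _ _ _ _ _ _ _ _ => I).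

Fixpoint MultiS (n : nat) : structcat (Multi R n) :=
  match n with 0 => trivial_str (Mod R) | m.+1 => twisted (MultiS m) end.

Fixpoint sLambdaB r n : sfunctor (MultiS n) (MultiS n) (LambdaB R r n) :=
  match n with
  | 0 => @SFunctor (Mod R) (Mod R) (trivial_str _) (trivial_str _) (Lambda R r)
           (fun _ _ => tt) (fun _ _ _ _ _ _ => I)
  | m.+1 => sNFGamma (sLambdaB r m)
  end.

(** Structures on all cubes at once, with functoriality: in the next step the last automorphism, as
    a morphism of cubes, has to preserve the structure. *)
Record scube n := SCube {
  scube_str : forall T : AutCat (Mod R) n, str (MultiS n) (cube R n T);
  scube_mor : forall (S T : AutCat (Mod R) n) (f : hom S T),
    smor (scube_str S) (scube_str T) (fmap (cube R n) f) }.

Definition two_str n (X : Multi R n) (s : str (MultiS n) X) k : str (MultiS n) (two_ob X k) :=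
  match k with
  | 0 | 1 => s
  | _ => zob_str (MultiS n)
  end.

(** The isomorphism ([a] in degree 1, the identity in degree 0) from the complex with differential
    [a] to the one with differential 1. *)
Definition two_tw n (X : Multi R n) (a : hom X X) k : hom (two_ob X k) (two_ob X k) :=
  match k with 0 => idc X | 1 => a | _ => 0 end.

Definition two_twisting n (X : Multi R n) (s : str (MultiS n) X) (a b : hom X X)
  (ab : a \oc b = idc X) (ba : b \oc a = idc X) (sa : smor s s a) (sb : smor s s b) :
  twisting (MultiS n) (two_term a).
Proof.
refine (@Twisting _ (MultiS n) (two_term a) (two_str s) (two_tw a) (two_tw b) _ _ _ _ _).
- by case=> [|[|k]] //=; rewrite ?comp1l // comp0m zob0.
- by case=> [|[|k]] //=; rewrite ?comp1l // comp0m zob0.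
- by case=> [|[|k]]; [apply: smor1 | | apply: smor0].
- by case=> [|[|k]]; [apply: smor1 | | apply: smor0].
- by case=> [|[|k]] /=; rewrite ?comp1l // !compm0.
Defined.

Lemma aut_last_iso n (T : auttuple (mod_cat R) n.+1) :
  is_iso (aut_last T : @hom (AutCat (mod_cat R) n) (aut_trunc T) (aut_trunc T)).
Proof.
have [g [ga ag]] := aut_iso T ord_max.
have gP i : g \oc aut (aut_trunc T) i = aut (aut_trunc T) i \oc g.
  exact: inv_comm ga ag (aut_comm T _ _).
exists (@AutMor _ _ (aut_trunc T) (aut_trunc T) g gP :
  @hom (AutCat (Mod R) n) (aut_trunc T) (aut_trunc T)).
by split; apply: autmor_ext.
Qed.

Definition scube_step_str n (sc : scube n) (T : AutCat (Mod R) n.+1) :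
  str (MultiS n.+1) (cube R n.+1 T).
Proof.
case: (cid (@aut_last_iso n T)) => g [gl lg].
refine (@two_twisting n (cube R n (aut_trunc T)) (scube_str sc (aut_trunc T))
  (@fmap _ _ (cube R n) (aut_trunc T) (aut_trunc T) (aut_last T)) (fmap (cube R n) g)
  _ _ (scube_mor sc _) (scube_mor sc _)).
- by rewrite -fmapM lg fmap1.
- by rewrite -fmapM gl fmap1.
Defined.

Definition scube_step n (sc : scube n) : scube n.+1.
Proof.
refine (@SCube n.+1 (scube_step_str sc) _) => S T f k.
(* The inverses were chosen separately for [S] and [T]; [tw_mor] compares only the automorphisms
   themselves. *)
rewrite /scube_step_str; case: (cid _) => gS [gSl lgS]; case: (cid _) => gT [gTl lgT].
case: k => [|[|k]] /=.
- split; first exact: (scube_mor sc (aut_trunc_map f)).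
  by rewrite comp1l comp1r.
- split; first exact: (scube_mor sc (aut_trunc_map f)).
  exact: cube_map_proof.
- by split; [apply: smor0 | rewrite comp0m].
Defined.

Fixpoint scubes n : scube n :=
  match n with
  | 0 => @SCube 0 (fun=> tt) (fun _ _ _ => I)
  | m.+1 => scube_step (scubes m)
  end.

End TwistedMulti.


(** * Biproducts and exactness *)

Section Biproducts.
Variable C : addcat.

(** Being given by equations, it passes to every degree of a complex and also covers sums other than
    the chosen [dsum]. *)
Definition biproduct (A B X : C) (i1 : hom A X) (i2 : hom B X)
    (p1 : hom X A) (p2 : hom X B) : Prop :=
  [/\ p1 \oc i1 = idc A, p2 \oc i2 = idc B, p1 \oc i2 = 0, p2 \oc i1 = 0
    & i1 \oc p1 + i2 \oc p2 = idc X].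

Definition bip_fam (A B : C) (b : bool) : C := if b then A else B.
Definition bip (A B : C) : C := dsum (bip_fam A B).

Variables A B : C.
Definition bi1 : hom A (bip A B) := inj (bip_fam A B) true.
Definition bi2 : hom B (bip A B) := inj (bip_fam A B) false.
Definition bp1 : hom (bip A B) A := proj (bip_fam A B) true.
Definition bp2 : hom (bip A B) B := proj (bip_fam A B) false.

Lemma bip_biproduct : biproduct bi1 bi2 bp1 bp2.
Proof.
split; [exact: (proj_inj (bip_fam A B) true) | exact: (proj_inj (bip_fam A B) false) | | |].
- exact: (@proj_injN _ _ (bip_fam A B) false true).
- exact: (@proj_injN _ _ (bip_fam A B) true false).
by have := dsum_id (bip_fam A B); rewrite big_bool.
Qed.

Lemma bp1i1 : bp1 \oc bi1 = idc A. Proof. by case: bip_biproduct. Qed.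
Lemma bp2i2 : bp2 \oc bi2 = idc B. Proof. by case: bip_biproduct. Qed.
Lemma bp1i2 : bp1 \oc bi2 = 0. Proof. by case: bip_biproduct. Qed.
Lemma bp2i1 : bp2 \oc bi1 = 0. Proof. by case: bip_biproduct. Qed.
Lemma bip_id : bi1 \oc bp1 + bi2 \oc bp2 = idc (bip A B).
Proof. by case: bip_biproduct. Qed.

Lemma bip_ext (X : C) (f g : hom (bip A B) X) :
  f \oc bi1 = g \oc bi1 -> f \oc bi2 = g \oc bi2 -> f = g.
Proof. by move=> e1 e2; apply: dsum_ext => -[]. Qed.

Definition pair (X : C) (f : hom X A) (g : hom X B) : hom X (bip A B) :=
  bi1 \oc f + bi2 \oc g.
Definition copair (X : C) (f : hom A X) (g : hom B X) : hom (bip A B) X :=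
  f \oc bp1 + g \oc bp2.

Lemma copair1 (X : C) (f : hom A X) (g : hom B X) : copair f g \oc bi1 = f.
Proof. by rewrite addm_comp -!compA bp1i1 bp2i1 comp1r compm0 addr0. Qed.
Lemma copair2 (X : C) (f : hom A X) (g : hom B X) : copair f g \oc bi2 = g.
Proof. by rewrite addm_comp -!compA bp1i2 bp2i2 comp1r compm0 add0r. Qed.
Lemma pair1 (X : C) (f : hom X A) (g : hom X B) : bp1 \oc pair f g = f.
Proof. by rewrite comp_addm !compA bp1i1 bp1i2 comp1l comp0m addr0. Qed.
Lemma pair2 (X : C) (f : hom X A) (g : hom X B) : bp2 \oc pair f g = g.
Proof. by rewrite comp_addm !compA bp2i1 bp2i2 comp1l comp0m add0r. Qed.

Lemma comp_copair (X Y : C) (h : hom X Y) (f : hom A X) (g : hom B X) :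
  h \oc copair f g = copair (h \oc f) (h \oc g).
Proof. by rewrite comp_addm !compA. Qed.
Lemma pair_comp (X Y : C) (h : hom Y X) (f : hom X A) (g : hom X B) :
  pair f g \oc h = pair (f \oc h) (g \oc h).
Proof. by rewrite addm_comp -!compA. Qed.

End Biproducts.

Arguments bi1 {C A B}.
Arguments bi2 {C A B}.
Arguments bp1 {C A B}.
Arguments bp2 {C A B}.

Section BiproductTheory.
Variable C : addcat.

Lemma copair_pair (A B X Y : C) (f : hom A X) (g : hom B X) (h : hom Y A) (k : hom Y B) :
  copair f g \oc pair h k = f \oc h + g \oc k.
Proof. by rewrite comp_addm !compA copair1 copair2. Qed.

Lemma pair_ext (A B X : C) (f g : hom X (bip A B)) :
  bp1 \oc f = bp1 \oc g -> bp2 \oc f = bp2 \oc g -> f = g.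
Proof.
by move=> e1 e2; rewrite -[f]comp1l -[g]comp1l -bip_id !addm_comp -!compA e1 e2.
Qed.

Definition bip_map (A B A' B' : C) (f : hom A A') (g : hom B B') :
  hom (bip A B) (bip A' B') := copair (bi1 \oc f) (bi2 \oc g).

Lemma bip_map1 (A B A' B' : C) (f : hom A A') (g : hom B B') :
  bip_map f g \oc bi1 = bi1 \oc f.
Proof. exact: copair1. Qed.
Lemma bip_map2 (A B A' B' : C) (f : hom A A') (g : hom B B') :
  bip_map f g \oc bi2 = bi2 \oc g.
Proof. exact: copair2. Qed.
Lemma bp1_map (A B A' B' : C) (f : hom A A') (g : hom B B') :
  bp1 \oc bip_map f g = f \oc bp1.
Proof.
by rewrite /bip_map comp_copair !compA bp1i1 bp1i2 comp1l comp0m /copair comp0m addr0.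
Qed.
Lemma bp2_map (A B A' B' : C) (f : hom A A') (g : hom B B') :
  bp2 \oc bip_map f g = g \oc bp2.
Proof.
by rewrite /bip_map comp_copair !compA bp2i1 bp2i2 comp1l comp0m /copair comp0m add0r.
Qed.

Lemma bip_mapM (A B A' B' A'' B'' : C) (f' : hom A' A'') (g' : hom B' B'')
    (f : hom A A') (g : hom B B') :
  bip_map f' g' \oc bip_map f g = bip_map (f' \oc f) (g' \oc g).
Proof.
by apply: bip_ext; rewrite -compA ?bip_map1 ?bip_map2 compA ?bip_map1 ?bip_map2 compA.
Qed.

Lemma bip_map_id (A B : C) : bip_map (idc A) (idc B) = idc (bip A B).
Proof. by apply: bip_ext; rewrite ?bip_map1 ?bip_map2 comp1l comp1r. Qed.

Lemma bip_map_iso (A B A' B' : C) (f : hom A A') (g : hom B B') :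
  is_iso f -> is_iso g -> is_iso (bip_map f g).
Proof.
case=> f' [f'f ff'] [g' [g'g gg']]; exists (bip_map f' g').
by rewrite !bip_mapM f'f ff' g'g gg' !bip_map_id.
Qed.

Lemma bip_zero (A B : C) : is_zero A -> is_zero B -> is_zero (bip A B).
Proof.
by move=> A0 B0; rewrite /is_zero -bip_id (zero_to bp1 A0) (zero_to bp2 B0) !compm0 addr0.
Qed.

End BiproductTheory.

(** * Split sequences and direct sums in the categories of multicomplexes *)

Section ExactMulti.
Variable R : comPzRingType.

Lemma modE (X Y : Mod R) (f g : hom X Y) :
  f = g -> forall x : (X : lmodType R), (f : {linear _ -> _}) x = (g : {linear _ -> _}) x.
Proof. by move=> ->. Qed.

Lemma modDE (X Y : Mod R) (f g : hom X Y) (x : (X : lmodType R)) :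
  ((f + g) : {linear _ -> _}) x = (f : {linear _ -> _}) x + (g : {linear _ -> _}) x.
Proof. by []. Qed.

Lemma modNE (X Y : Mod R) (f : hom X Y) (x : (X : lmodType R)) :
  ((- f) : {linear _ -> _}) x = - (f : {linear _ -> _}) x.
Proof. by []. Qed.

(** Exactness and the splitting equations are both inherited by each degree, so induction on [n]
    reduces this to modules. *)
Lemma Multi_ses_split n (X Y Z : Multi R n) (f : hom X Y) (g : hom Y Z)
    (r : hom Y X) (s : hom Z Y) :
  biproduct f s r g -> ses f g.
Proof.
elim: n X Y Z f g r s => [|n IH] X Y Z f g r s [rf gs rs gf e] /=.
  split=> [x x' exx|z|y].
  - by have := modE rf x; rewrite /= exx => <-; have := modE rf x'.
  - by exists ((s : {linear _ -> _}) z); apply: (modE gs).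
  split=> [gy0|[x <-]]; last exact: (modE gf).
  exists ((r : {linear _ -> _}) y); have := modE e y.
  by rewrite modDE /= gy0 linear0 addr0.
move=> k; apply: (IH _ _ _ _ _ ((r : bmor Y X) k) ((s : bmor Z Y) k)).
split.
- by have := congr1 (fun u : bmor X X => u k) rf.
- by have := congr1 (fun u : bmor Z Z => u k) gs.
- by have := congr1 (fun u : bmor Z X => u k) rs.
- by have := congr1 (fun u : bmor X Z => u k) gf.
- by have := congr1 (fun u : bmor Y Y => u k) e.
Qed.

Lemma Multi_ses_opp n (X Y Z : Multi R n) (f : hom X Y) (g : hom Y Z) :
  ses f g -> ses f (- g).
Proof.
elim: n X Y Z f g => [|n IH] X Y Z f g /=; last by move=> fg k; apply: IH.
case=> [fi gs ex]; split=> // [z|y].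
  by have [y e] := gs (- z); exists y; rewrite modNE e opprK.
by rewrite modNE -(ex y); split=> /eqP; rewrite ?oppr_eq0 => /eqP // ->; rewrite oppr0.
Qed.

(** The direct sum of two exact sequences is exact. Arbitrary biproducts are allowed so that the
    induction can pass to degree [k]. *)
Lemma Multi_ses_biproduct n (X1 X2 X Y1 Y2 Y Z1 Z2 Z : Multi R n)
    i1 i2 p1 p2 j1 j2 q1 q2 k1 k2 r1 r2
    (f1 : hom X1 Y1) (f2 : hom X2 Y2) (f : hom X Y)
    (g1 : hom Y1 Z1) (g2 : hom Y2 Z2) (g : hom Y Z) :
  @biproduct _ X1 X2 X i1 i2 p1 p2 -> @biproduct _ Y1 Y2 Y j1 j2 q1 q2 ->
  @biproduct _ Z1 Z2 Z k1 k2 r1 r2 ->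
  f \oc i1 = j1 \oc f1 -> f \oc i2 = j2 \oc f2 ->
  g \oc j1 = k1 \oc g1 -> g \oc j2 = k2 \oc g2 ->
  q1 \oc f = f1 \oc p1 -> q2 \oc f = f2 \oc p2 ->
  r1 \oc g = g1 \oc q1 -> r2 \oc g = g2 \oc q2 ->
  ses f1 g1 -> ses f2 g2 -> ses f g.
Proof.
elim: n X1 X2 X Y1 Y2 Y Z1 Z2 Z i1 i2 p1 p2 j1 j2 q1 q2 k1 k2 r1 r2 f1 f2 f g1 g2 g
    => [|n IH] X1 X2 X Y1 Y2 Y Z1 Z2 Z i1 i2 p1 p2 j1 j2 q1 q2 k1 k2 r1 r2
      f1 f2 f g1 g2 g bX bY bZ fi1 fi2 gj1 gj2 qf1 qf2 rg1 rg2.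
  case: bX bY bZ => _ _ _ _ eX [_ _ _ _ eY] [_ _ _ _ eZ].
  case=> [inj1 sur1 ex1] [inj2 sur2 ex2]; split=> [x x' exx|z|y].
  - have e1 : (p1 : {linear _ -> _}) x = (p1 : {linear _ -> _}) x'.
      by apply: inj1; rewrite -[LHS](modE qf1) -[RHS](modE qf1) /= exx.
    have e2 : (p2 : {linear _ -> _}) x = (p2 : {linear _ -> _}) x'.
      by apply: inj2; rewrite -[LHS](modE qf2) -[RHS](modE qf2) /= exx.
    by rewrite -[x](modE eX) -[x'](modE eX) /= e1 e2.
  - have [y1 ey1] := sur1 ((r1 : {linear _ -> _}) z).
    have [y2 ey2] := sur2 ((r2 : {linear _ -> _}) z).
    exists ((j1 : {linear _ -> _}) y1 + (j2 : {linear _ -> _}) y2).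
    rewrite linearD -[z](modE eZ) /=; congr (_ + _).
      by rewrite [LHS](modE gj1) /= ey1.
    by rewrite [LHS](modE gj2) /= ey2.
  split=> [gy0|[x <-]].
    have [|x1 ex1'] := proj1 (ex1 ((q1 : {linear _ -> _}) y)).
      by rewrite -[LHS](modE rg1) /= gy0 linear0.
    have [|x2 ex2'] := proj1 (ex2 ((q2 : {linear _ -> _}) y)).
      by rewrite -[LHS](modE rg2) /= gy0 linear0.
    exists ((i1 : {linear _ -> _}) x1 + (i2 : {linear _ -> _}) x2).
    rewrite linearD -[y](modE eY) /=; congr (_ + _).
      by rewrite [LHS](modE fi1) /= ex1'.
    by rewrite [LHS](modE fi2) /= ex2'.
  rewrite -[LHS](modE eZ) /=.
  have -> : (r1 : {linear _ -> _}) ((g : {linear _ -> _}) ((f : {linear _ -> _}) x)) = 0.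
    rewrite [LHS](modE rg1) /=; apply/ex1; exists ((p1 : {linear _ -> _}) x).
    by rewrite -[LHS](modE qf1).
  have -> : (r2 : {linear _ -> _}) ((g : {linear _ -> _}) ((f : {linear _ -> _}) x)) = 0.
    rewrite [LHS](modE rg2) /=; apply/ex2; exists ((p2 : {linear _ -> _}) x).
    by rewrite -[LHS](modE qf2).
  by rewrite !linear0 addr0.
have bk (A B D : Multi R n.+1) a1 a2 b1 b2 k : @biproduct _ A B D a1 a2 b1 b2 ->
    biproduct ((a1 : bmor A D) k) ((a2 : bmor B D) k) ((b1 : bmor D A) k) ((b2 : bmor D B) k).
  case=> h1 h2 h3 h4 h5; split.
  - by have := congr1 (fun u : bmor A A => u k) h1.
  - by have := congr1 (fun u : bmor B B => u k) h2.
  - by have := congr1 (fun u : bmor B A => u k) h3.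
  - by have := congr1 (fun u : bmor A B => u k) h4.
  - by have := congr1 (fun u : bmor D D => u k) h5.
move=> s1 s2 k; apply: (IH _ _ _ _ _ _ _ _ _ _ _ _ _ _ _ _ _ _ _ _ _ _ _ _ _ _ _
  (bk _ _ _ _ _ _ _ k bX) (bk _ _ _ _ _ _ _ k bY) (bk _ _ _ _ _ _ _ k bZ)
  _ _ _ _ _ _ _ _ (s1 k) (s2 k)).
- by have := congr1 (fun u : bmor X1 Y => u k) fi1.
- by have := congr1 (fun u : bmor X2 Y => u k) fi2.
- by have := congr1 (fun u : bmor Y1 Z => u k) gj1.
- by have := congr1 (fun u : bmor Y2 Z => u k) gj2.
- by have := congr1 (fun u : bmor X Y1 => u k) qf1.
- by have := congr1 (fun u : bmor X Y2 => u k) qf2.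
- by have := congr1 (fun u : bmor Y Z1 => u k) rg1.
- by have := congr1 (fun u : bmor Y Z2 => u k) rg2.
Qed.

Lemma fg_projective_biproduct (A B X : Mod R) i1 i2 p1 p2 :
  @biproduct (Mod R) A B X i1 i2 p1 p2 ->
  fg_projective A -> fg_projective B -> fg_projective X.
Proof.
case=> _ _ _ _ e [[m [u hu]] pA] [[n [v hv]] pB]; split.
  exists (m + n)%N, (fun k => match split k with
    | inl a => (i1 : {linear _ -> _}) (u a) | inr b => (i2 : {linear _ -> _}) (v b) end).
  move=> x; have [a ea] := hu ((p1 : {linear _ -> _}) x).
  have [b eb] := hv ((p2 : {linear _ -> _}) x).
  exists (fun k => match split k with inl i => a i | inr i => b i end).
  rewrite big_split_ord -[x in LHS](modE e) /= ea eb !linear_sum; congr (_ + _).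
    by apply: eq_bigr => i _; rewrite (unsplitK (inl i)) linearZ.
  by apply: eq_bigr => i _; rewrite (unsplitK (inr i)) linearZ.
move=> S T g f sg.
have [h1 eh1] := pA S T g (f \o (i1 : {linear _ -> _}) : {linear _ -> _}) sg.
have [h2 eh2] := pB S T g (f \o (i2 : {linear _ -> _}) : {linear _ -> _}) sg.
exists ((h1 \o (p1 : {linear _ -> _})) \+ (h2 \o (p2 : {linear _ -> _})) : {linear _ -> _}).
move=> x; rewrite /= linearD eh1 eh2 /= -linearD; congr (f _).
by have := modE e x; rewrite modDE.
Qed.

(** The cycle objects of [X] are taken to be the sums of those of [A] and [B]. *)
Lemma inB_biproduct n (A B X : Multi R n) i1 i2 p1 p2 :
  @biproduct _ A B X i1 i2 p1 p2 -> inB A -> inB B -> inB X.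
Proof.
elim: n A B X i1 i2 p1 p2 => [|n IH] A B X i1 i2 p1 p2 bX.
  exact: fg_projective_biproduct bX.
case=> [cA [NA zA] aA] [cB [NB zB] aB].
have bk k : biproduct ((i1 : bmor A X) k) ((i2 : bmor B X) k)
    ((p1 : bmor X A) k) ((p2 : bmor X B) k).
  case: bX => h1 h2 h3 h4 h5; split.
  - by have := congr1 (fun u : bmor A A => u k) h1.
  - by have := congr1 (fun u : bmor B B => u k) h2.
  - by have := congr1 (fun u : bmor B A => u k) h3.
  - by have := congr1 (fun u : bmor A B => u k) h4.
  - by have := congr1 (fun u : bmor X X => u k) h5.
have IHbip (A' B' : Multi R n) : inB A' -> inB B' -> inB (bip A' B').
  exact/IH/bip_biproduct.
split=> [k||b].
- exact: (IH _ _ _ _ _ _ _ (bk k) (cA k) (cB k)).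
- exists (maxn NA NB) => k; rewrite geq_max => /andP[hA hB].
  have [_ _ _ _ e] := bk k.
  rewrite /is_zero -e (zero_to ((p1 : bmor X A) k) (zA k hA)).
  by rewrite (zero_to ((p2 : bmor X B) k) (zB k hB)) !compm0 addr0.
have [ZA [iA [pA [EA isoA sA dA]]]] := aA b.
have [ZB [iB [pB [EB isoB sB dB]]]] := aB b.
pose i k : hom (bip (ZA k) (ZB k)) ((X : bcomplex _) k) :=
  copair ((i1 : bmor A X) k \oc iA k) ((i2 : bmor B X) k \oc iB k).
pose p k : hom ((X : bcomplex _) k.+1) (bip (ZA k) (ZB k)) :=
  pair (pA k \oc (p1 : bmor X A) k.+1) (pB k \oc (p2 : bmor X B) k.+1).
exists (fun k => bip (ZA k) (ZB k)), i, p; split.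
- by move=> k; exact: IHbip (EA k) (EB k).
- have [jA [jiA ijA]] := isoA; have [jB [jiB ijB]] := isoB.
  have [h1 h2 h3 h4 h5] := bk 0%N.
  exists (pair (jA \oc (p1 : bmor X A) 0%N) (jB \oc (p2 : bmor X B) 0%N)); split.
    rewrite /i; apply: bip_ext; rewrite -compA ?copair1 ?copair2 pair_comp comp1l -!compA.
      by rewrite !(compA _ ((i1 : bmor A X) 0%N)) h1 h4 comp1l comp0m compm0 jiA /pair
        comp1r compm0 addr0.
    by rewrite !(compA _ ((i2 : bmor B X) 0%N)) h2 h3 comp1l comp0m compm0 jiB /pair
      comp1r compm0 add0r.
  by rewrite /i copair_pair !compA -(compA _ (iA 0%N)) ijA -(compA _ (iB 0%N)) ijB !comp1r.
- move=> k; have [h1 h2 h3 h4 h5] := bk k.+1.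
  apply: (Multi_ses_biproduct (bip_biproduct _ _) (bk k.+1) (bip_biproduct _ _)
    _ _ _ _ _ _ _ _ (sA k) (sB k)).
  + exact: copair1.
  + exact: copair2.
  + by rewrite pair_comp -!compA h1 h4 !compm0 comp1r /pair compm0 addr0.
  + by rewrite pair_comp -!compA h2 h3 !compm0 comp1r /pair compm0 add0r.
  + by rewrite /i comp_copair !compA h1 h3 /copair !comp0m comp1l addr0.
  + by rewrite /i comp_copair !compA h2 h4 /copair !comp0m comp1l add0r.
  + exact: pair1.
  + exact: pair2.
- move=> k; rewrite /i /p copair_pair -!compA.
  rewrite (compA (iA k)) (compA (iB k)) -dA -dB !compA.
  rewrite -(bmapP (i1 : bmor A X)) -(bmapP (i2 : bmor B X)) -!compA -comp_addm.
  by have [_ _ _ _ ->] := bk k.+1; rewrite comp1r.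
Qed.

Lemma inB_bip n (A B : Multi R n) : inB A -> inB B -> inB (bip A B).
Proof. exact/inB_biproduct/bip_biproduct. Qed.

End ExactMulti.


(** * Shifts and cones *)

Section Shift.
Variable C : addcat.

Lemma bmor_iso (X Y : bcomplex C) (f : bmor X Y) :
  (forall k, is_iso (f k)) -> is_iso (f : @hom (BC C) X Y).
Proof.
move=> fI; pose g k := projT1 (cid (fI k)).
have gf k : g k \oc f k = idc (X k) by rewrite /g; case: cid => h [].
have fg k : f k \oc g k = idc (Y k) by rewrite /g; case: cid => h [].
have gP b k : bd X b k \oc g k.+1 = g k \oc bd Y b k.
  rewrite -[LHS]comp1l -gf -compA (compA (f k)) -bmapP -(compA (bd Y b k)) fg.
  by rewrite comp1r.
by exists (BMor gP : @hom (BC C) Y X); split; apply: bmor_ext.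
Qed.

Lemma iso_bmor (X Y : bcomplex C) (f : bmor X Y) :
  is_iso (f : @hom (BC C) X Y) -> forall k, is_iso (f k).
Proof.
case=> g [gf fg] k; exists ((g : bmor Y X) k); split.
  by have := congr1 (fun u : bmor X X => u k) gf.
by have := congr1 (fun u : bmor Y Y => u k) fg.
Qed.

Definition pre (X : bcomplex C) k : C := if k is k'.+1 then X k' else zob C.

Definition pre_d (X : bcomplex C) b k : hom (pre X k.+1) (pre X k) :=
  match k with 0 => 0 | k'.+1 => bd X b k' end.

Fact pre_dd (X : bcomplex C) b k : pre_d X b k \oc pre_d X b k.+1 = 0.
Proof. by case: k => [|k]; rewrite /= ?comp0m ?bdd. Qed.

(** The suspension without a change of sign; the usual sign is supplied separately by [neg]. *)
Definition shift (X : bcomplex C) : bcomplex C := BComplex (pre_dd X).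

Definition pre_map (X Y : bcomplex C) (f : bmor X Y) k : hom (pre X k) (pre Y k) :=
  match k with 0 => 0 | k'.+1 => f k' end.

Fact shift_morP (X Y : bcomplex C) (f : bmor X Y) b k :
  pre_d Y b k \oc pre_map f k.+1 = pre_map f k \oc pre_d X b k.
Proof. by case: k => [|k] /=; rewrite ?comp0m ?bmapP. Qed.

Definition shift_mor (X Y : bcomplex C) (f : bmor X Y) : bmor (shift X) (shift Y) :=
  @BMor C (shift X) (shift Y) (pre_map f) (shift_morP f).

Lemma pre_map_iso (X Y : bcomplex C) (f : bmor X Y) :
  (forall k, is_iso (f k)) -> forall k, is_iso (pre_map f k).
Proof. by move=> fI [|k] //=; apply: zero_iso; apply: zob0. Qed.

Lemma pre_mapC (X : bcomplex C) (f g : bmor X X) :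
  (forall k, f k \oc g k = g k \oc f k) ->
  forall k, pre_map f k \oc pre_map g k = pre_map g k \oc pre_map f k.
Proof. by move=> fg [|k] /=; rewrite ?comp0m. Qed.

Definition drop (X : bcomplex C) : bcomplex C :=
  @BComplex C (fun k => X k.+1) (fun b k => bd X b k.+1) (fun b k => bdd X b k.+1).

Definition drop_mor (X Y : bcomplex C) (f : bmor X Y) : bmor (drop X) (drop Y) :=
  @BMor C (drop X) (drop Y) (fun k => f k.+1) (fun b k => bmapP f b k.+1).

Fact neg_dd (X : bcomplex C) b k : (- bd X b k) \oc (- bd X b k.+1) = 0.
Proof. by rewrite opp_comp comp_opp bdd !oppr0. Qed.

Definition neg (X : bcomplex C) : bcomplex C :=
  @BComplex C X (fun b k => - bd X b k) (neg_dd X).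

Fact neg_morP (X Y : bcomplex C) (f : bmor X Y) b k :
  (- bd Y b k) \oc f k.+1 = f k \oc (- bd X b k).
Proof. by rewrite opp_comp comp_opp bmapP. Qed.

Definition neg_mor (X Y : bcomplex C) (f : bmor X Y) : bmor (neg X) (neg Y) :=
  @BMor C (neg X) (neg Y) f (neg_morP f).

(** The signs (-1)^k, which identify [neg X] with [X]. *)
Definition altern (X : bcomplex C) k : hom (X k) (X k) :=
  if odd k then - idc (X k) else idc (X k).

Fact alternP (X : bcomplex C) b k :
  bd X b k \oc altern X k.+1 = altern X k \oc (- bd X b k).
Proof.
by rewrite /altern /=; case: odd; rewrite /= ?comp_opp ?opp_comp ?opprK comp1l comp1r.
Qed.

Definition neg_iso (X : bcomplex C) : bmor (neg X) X := @BMor C (neg X) X _ (alternP X).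

Lemma altern_iso (X : bcomplex C) k : is_iso (altern X k).
Proof.
exists (altern X k); rewrite /altern; case: odd => /=; last by rewrite comp1l.
by rewrite comp_opp opp_comp opprK comp1l.
Qed.

Lemma alternC (X : bcomplex C) (f : bmor X X) k : altern X k \oc f k = f k \oc altern X k.
Proof. by rewrite /altern; case: odd; rewrite ?opp_comp ?comp_opp comp1l comp1r. Qed.

End Shift.

(** * The cone of the pair (theta, id) and its filtration by rows *)

Section Cone.
Variable C : addcat.

Definition or_id (X : nat -> C) (th : forall k, hom (X k) (X k)) (b : bool) k :
    hom (X k) (X k) := if b then idc (X k) else th k.

(* A graded automorphism it_map such that it_map and id are chain maps from
   (X, d) resp. (X, \tilde d) to X with the differentials it_d. *)
Record itw (X : bcomplex C) := Itw {
  it_d : bool -> forall k, hom (X k.+1) (X k);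
  it_dd : forall b k, it_d b k \oc it_d b k.+1 = 0;
  it_map : forall k, hom (X k) (X k);
  it_mapP : forall b k, it_d b k \oc or_id it_map b k.+1 = or_id it_map b k \oc bd X b k }.

Definition target (X : bcomplex C) (c : itw X) : bcomplex C := BComplex (it_dd c).

Fact id_itwP (X : bcomplex C) b k :
  bd X b k \oc or_id (fun k => idc (X k)) b k.+1 =
  or_id (fun k => idc (X k)) b k \oc bd X b k.
Proof. by rewrite /or_id !if_same comp1l comp1r. Qed.

Definition id_itw (X : bcomplex C) : itw X := @Itw X (bd X) (bdd X) _ (id_itwP X).

Definition drop_itw (X : bcomplex C) (c : itw X) : itw (drop X) :=
  @Itw (drop X) (fun b k => it_d c b k.+1) (fun b k => it_dd c b k.+1)
    (fun k => it_map c k.+1) (fun b k => it_mapP c b k.+1).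

Section OneCone.
Variables (X : bcomplex C) (c : itw X).

Definition cone_ob k : C := bip (X k) (pre X k).

(** The mapping cone of theta for [b = false] and of the identity for [b = true]: (x, y) goes to
    (it_d x + theta y, - d y). *)
Definition cone_d b k : hom (cone_ob k.+1) (cone_ob k) :=
  copair (bi1 \oc it_d c b k) (pair (or_id (it_map c) b k) (- pre_d X b k)).

Fact cone_dd b k : cone_d b k \oc cone_d b k.+1 = 0.
Proof.
apply: bip_ext; rewrite -compA /cone_d ?copair1 ?copair2 comp0m.
  by rewrite compA copair1 -compA it_dd compm0.
rewrite copair_pair -compA it_mapP comp_opp /pair addm_comp -!compA opp_comp.
by rewrite (pre_dd X b k) oppr0 compm0 addr0 subrr.
Qed.

Definition cone : bcomplex C := BComplex cone_dd.

Fact cone_inP b k : cone_d b k \oc bi1 = bi1 \oc it_d c b k.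
Proof. exact: copair1. Qed.

Definition cone_in : bmor (target c) cone :=
  @BMor C (target c) cone (fun k => bi1) cone_inP.

Fact cone_outP b k : pre_d (neg X) b k \oc bp2 = bp2 \oc cone_d b k.
Proof.
apply: bip_ext; rewrite -!compA /cone_d ?copair1 ?copair2.
  by rewrite bp2i1 compA bp2i1 comp0m compm0.
by rewrite bp2i2 pair2 comp1r; case: k => [|k] //=; rewrite oppr0.
Qed.

Definition cone_out : bmor cone (shift (neg X)) :=
  @BMor C cone (shift (neg X)) (fun k => bp2) cone_outP.

(** The two copies of [X 0], in degrees 0 and 1 of the cone, form a subcomplex with differentials
    theta and 1: the first row. *)
Definition row_in_map k : hom (two_ob (X 0%N) k) (cone_ob k) :=
  match k with 0 => bi1 | 1 => bi2 | _ => 0 end.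

Fact row_inP b k : cone_d b k \oc row_in_map k.+1 =
  row_in_map k \oc two_d (it_map c 0) b k.
Proof.
case: k => [|k] /=; last by rewrite !compm0.
by rewrite /cone_d copair2 /pair oppr0 compm0 addr0 /or_id.
Qed.

Definition row_in : bmor (two_term (it_map c 0)) cone :=
  @BMor C (two_term (it_map c 0)) cone row_in_map row_inP.

End OneCone.

Section Row.
Variables (X : bcomplex C) (c : itw X).

(** The quotient by the first row is the shifted cone of the truncation of [X]. From degree 2 on the
    terms agree; in degree 1 the summand [X 0] is replaced by zero. *)
Definition row_out_map k : hom (cone_ob X k) (pre (cone (drop_itw c)) k) :=
  match k with 0 => 0 | 1 => bi1 \oc bp1 | k'.+2 => idc (cone_ob X k'.+2) end.

Fact row_outP b k : pre_d (cone (drop_itw c)) b k \oc row_out_map k.+1 =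
  row_out_map k \oc cone_d c b k.
Proof.
case: k => [|[|k]] /=; first by rewrite !comp0m.
  rewrite comp1r; apply: bip_ext; rewrite /cone_d -!compA ?copair1 ?copair2 /=.
    by rewrite (compA bp1) bp1i1 comp1l.
  by rewrite pair1 /pair oppr0 compm0 addr0.
by rewrite comp1l comp1r.
Qed.

Definition row_out : bmor (cone c) (shift (cone (drop_itw c))) :=
  @BMor C (cone c) (shift (cone (drop_itw c))) row_out_map row_outP.

(** The splittings are not chain maps, but exactness of a sequence of complexes is tested in each
    degree. *)
Lemma row_biproduct k : exists r s, biproduct (row_in c k) s r (row_out k).
Proof.
have z0 (A : C) : bi2 \oc bp2 = 0 :> hom (bip A (zob C)) (bip A (zob C)).
  by rewrite (zero_from bi2) ?comp0m //; apply: zob0.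
case: k => [|[|k]] /=.
- exists bp1, 0; split; rewrite ?compm0 ?comp0m ?bp1i1 //; first by rewrite [RHS]zob0.
  by rewrite -[RHS]bip_id z0.
- exists bp2, (bi1 \oc bp1); split.
  + exact: bp2i2.
  + by rewrite -compA (compA bp1) bp1i1 comp1l -[RHS]bip_id z0 addr0.
  + by rewrite compA bp2i1 comp0m.
  + by rewrite -compA bp1i2 compm0.
  + by rewrite -[X in _ + X]compA (compA bp1) bp1i1 comp1l addrC bip_id.
- exists 0, (idc _); split; rewrite ?compm0 ?comp0m ?comp1l ?add0r //.
  by rewrite [RHS]zob0.
Qed.

End Row.

Definition compat (X : bcomplex C) (c : itw X) (f : bmor X X) : Prop :=
  (forall b k, it_d c b k \oc f k.+1 = f k \oc it_d c b k) /\
  (forall k, f k \oc it_map c k = it_map c k \oc f k).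

Section ConeAction.
Variables (X : bcomplex C) (c : itw X) (f : bmor X X) (cf : compat c f).

Definition target_act : bmor (target c) (target c) :=
  @BMor C (target c) (target c) f (proj1 cf).

Definition cone_map k : hom (cone_ob X k) (cone_ob X k) := bip_map (f k) (pre_map f k).

Fact cone_mapP b k : cone_d c b k \oc cone_map k.+1 = cone_map k \oc cone_d c b k.
Proof.
apply: bip_ext; rewrite -!compA /cone_map /cone_d ?bip_map1 ?bip_map2 ?copair1 ?copair2.
  by rewrite !compA copair1 bip_map1 -!compA (proj1 cf).
rewrite !compA copair2; apply: pair_ext.
  rewrite !compA pair1 bp1_map -compA pair1 /or_id; case: b; first by rewrite comp1l comp1r.
  by rewrite -(proj2 cf).
rewrite !compA pair2 bp2_map -compA pair2 opp_comp comp_opp; congr (- _).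
exact: shift_morP.
Qed.

Definition cone_act : bmor (cone c) (cone c) := @BMor C (cone c) (cone c) cone_map cone_mapP.

Lemma cone_act_iso : (forall k, is_iso (f k)) -> forall k, is_iso (cone_act k).
Proof. by move=> fI k; apply: bip_map_iso => //; apply: pre_map_iso. Qed.

Lemma drop_compat : compat (drop_itw c) (drop_mor f).
Proof. by split=> [b k|k]; [apply: (proj1 cf) | apply: (proj2 cf)]. Qed.

Lemma row_in_act k : row_in c k \oc two_mor (proj2 cf 0%N) k = cone_act k \oc row_in c k.
Proof.
case: k => [|[|k]] /=; rewrite ?compm0 //; first by rewrite /cone_map bip_map1.
by rewrite /cone_map bip_map2.
Qed.

End ConeAction.

Lemma row_out_act (X : bcomplex C) (c : itw X) (f : bmor X X) (cf : compat c f) k :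
  row_out c k \oc cone_act cf k = shift_mor (cone_act (drop_compat cf)) k \oc row_out c k.
Proof.
case: k => [|[|k]] /=; first by rewrite !comp0m.
  by rewrite /cone_map -compA bp1_map !compA bip_map1.
by rewrite comp1l comp1r.
Qed.

Lemma cone_actC (X : bcomplex C) (c : itw X) (f g : bmor X X) (cf : compat c f)
    (cg : compat c g) : (forall k, f k \oc g k = g k \oc f k) ->
  forall k, cone_act cf k \oc cone_act cg k = cone_act cg k \oc cone_act cf k.
Proof. by move=> fg k; rewrite /= /cone_map !bip_mapM fg pre_mapC. Qed.

End Cone.

(** * Acyclicity of shifts and cones *)

Section ConeInB.
Variable R : comPzRingType.

Lemma inB_shift n (X : Multi R n.+1) : inB X -> inB (shift X : Multi R n.+1).
Proof.
case=> cX [N zX] aX; split.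
- by case=> [|k] /=; [apply/zero_inB/zob0 | apply: cX].
- by exists N.+1 => -[|k] //; apply: zX.
move=> b; have [Z [i [p [EZ isoi si di]]]] := aX b.
exists (fun k => if k is k'.+1 then Z k' else zob _).
exists (fun k => match k return hom (if k is k'.+1 then Z k' else zob _) (pre X k) with
  | 0 => idc _ | k'.+1 => i k' end).
exists (fun k => match k return hom (pre X k.+1) (if k is k'.+1 then Z k' else zob _) with
  | 0 => 0 | k'.+1 => p k' end).
split.
- by case=> [|k]; [apply/zero_inB/zob0 | apply: EZ].
- exact: id_iso.
- case=> [|k] /=; last exact: si.
  have [j [ji ij]] := isoi; apply: (Multi_ses_split (r := j) (s := 0)).
  split=> //; rewrite ?compm0 ?comp0m ?addr0 //.
  by rewrite [RHS]zob0.
- by case=> [|k] /=; rewrite ?compm0 ?di.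
Qed.

Lemma inB_neg n (X : Multi R n.+1) : inB X -> inB (neg X : Multi R n.+1).
Proof.
case=> cX sX aX; split=> // b; have [Z [i [p [EZ isoi si di]]]] := aX b.
exists Z, i, (fun k => - p k); split=> // k; first exact: Multi_ses_opp.
by rewrite /= di comp_opp.
Qed.

(** The cone of an isomorphism is contractible. A cycle (x, y) satisfies y = - theta^-1 it_d x, so
    the cycles in degree [k] are the graph of [j k], a copy of [X k]. *)
Lemma inB_cone n (X : bcomplex (Multi R n)) (c : itw X) :
  (forall k, inB (X k)) -> finite_support X -> (forall k, is_iso (it_map c k)) ->
  inB (cone c : Multi R n.+1).
Proof.
move=> cX [N zX] cI; split.
- by move=> k; apply: inB_bip => //; case: k => [|k] /=; [apply/zero_inB/zob0|].
- exists N.+1 => k Nk; apply: bip_zero; first exact/zX/ltnW.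
  by case: k Nk => [|k] //=; apply: zX.
move=> b; have ex k : exists v : hom (X k) (X k),
    v \oc or_id (it_map c) b k = idc (X k) /\ or_id (it_map c) b k \oc v = idc (X k).
  by rewrite /or_id; case: b; [apply: id_iso | apply: cI].
pose V k := projT1 (cid (ex k)); have hV k := projT2 (cid (ex k)); rewrite -/(V _) in hV.
pose j k : hom (X k) (pre X k) :=
  match k return hom (X k) (pre X k) with 0 => 0 | k'.+1 => - (V k' \oc it_d c b k') end.
exists X, (fun k => pair (idc (X k)) (j k)),
  (fun k => copair (it_d c b k) (or_id (it_map c) b k)); split=> // [|k|k].
- exists bp1; rewrite pair1; split=> //; apply: pair_ext.
    by rewrite compA pair1 comp1l comp1r.
  by rewrite compA pair2 comp1r comp0m (zero_to bp2) //; apply: zob0.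
(* An element z of [X k] is hit by (0, V z), and a cycle is recovered from its first coordinate. *)
- apply: (Multi_ses_split (r := bp1) (s := bi2 \oc V k)); split.
  + exact: pair1.
  + by rewrite compA copair2 (proj2 (hV k)).
  + by rewrite compA bp1i2 comp0m.
  + by rewrite copair_pair comp1r /= comp_opp compA (proj2 (hV k)) comp1l subrr.
  + apply: bip_ext; rewrite addm_comp comp1l -!compA ?bp1i1 ?bp1i2 ?copair1 ?copair2.
      by rewrite comp1r /pair comp1r -addrA -comp_addm addNr compm0 addr0.
    by rewrite (proj1 (hV k)) comp1r compm0 add0r.
move=> /=; apply: bip_ext; rewrite /cone_d -compA ?copair1 ?copair2 pair_comp comp1l.
  rewrite (_ : j k \oc _ = 0) /pair ?compm0 ?addr0 //.
  by case: k => [|k] /=; rewrite ?comp0m // opp_comp -compA it_dd compm0 oppr0.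
congr pair; case: k => [|k] /=; first by rewrite comp0m oppr0.
by rewrite opp_comp -compA it_mapP compA (proj1 (hV k)) comp1l.
Qed.

End ConeInB.


(** * Predicates closed under two-out-of-three *)

Section ThickPredicates.
Variable R : comPzRingType.

(* Only finitely many of the endomorphisms matter; the infinite family avoids
   keeping track of their number. *)
Record endob (C : category) := EndOb { eob :> C; eact : nat -> hom eob eob }.

Definition equivariant (C : category) (X Y : endob C) (f : hom X Y) : Prop :=
  forall j, f \oc eact X j = eact Y j \oc f.

Definition admissible n (X : endob (Multi R n)) : Prop :=
  [/\ inB X, forall j, is_iso (eact X j)
    & forall i j, eact X i \oc eact X j = eact X j \oc eact X i].

(** The properties of membership in the image that the argument uses. Working with an abstract [M]
    allows an induction on the number of directions in which [M] is replaced by [descend M]. *)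
Record thick n (M : endob (Multi R n) -> Prop) : Prop := Thick {
  thick_quot : forall (X Y Z : endob (Multi R n)) (f : hom X Y) (g : hom Y Z),
    admissible X -> admissible Y -> admissible Z ->
    equivariant f -> equivariant g -> ses f g ->
    M X -> M Y -> M Z;
  thick_sub : forall (X Y Z : endob (Multi R n)) (f : hom X Y) (g : hom Y Z),
    admissible X -> admissible Y -> admissible Z ->
    equivariant f -> equivariant g -> ses f g ->
    M Y -> M Z -> M X;
  thick_mid : forall (X Y Z : endob (Multi R n)) (f : hom X Y) (g : hom Y Z),
    admissible X -> admissible Y -> admissible Z ->
    equivariant f -> equivariant g -> ses f g ->
    M X -> M Z -> M Y;
  thick_diag : forall X : endob (Multi R n), admissible X -> diagonal X -> M X }.

Section ThickComplexes.
Variables (n : nat) (M : endob (Multi R n.+1) -> Prop).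
Hypothesis tM : thick M.

Local Notation bc X := (eob X : bcomplex (Multi R n)).
Local Notation bact X j := (eact X j : bmor (bc X) (bc X)).

Lemma outer_diagonal (X : bcomplex (Multi R n)) :
  (forall k, bd X false k = bd X true k) -> diagonal (X : Multi R n.+1).
Proof. by move=> e; exists n => //=; rewrite eqxx. Qed.

Lemma thick_zero (X : endob (Multi R n.+1)) : is_zero X -> M X.
Proof.
move=> X0; have X0k k : is_zero (bc X k).
  by have := congr1 (fun u : bmor (bc X) (bc X) => u k) X0.
apply: (thick_diag tM); last first.
  by apply: outer_diagonal => k; rewrite (zero_to (bd _ false k)) // (zero_to (bd _ true k)).
split; first exact: zero_inB.
  by move=> j; apply: zero_iso.
by move=> i j; rewrite (zero_to (eact X i)) // comp0m compm0.
Qed.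

(** An isomorphism exhibits its target as the quotient by a zero object. *)
Lemma thick_iso (X Y : endob (Multi R n.+1)) (f : hom X Y) :
  admissible X -> admissible Y -> equivariant f -> is_iso f -> M X -> M Y.
Proof.
move=> aX aY ef fI; have z0 := zob0 (Multi R n.+1).
pose Z := @EndOb (Multi R n.+1) (zob _) (fun=> 0).
apply: (thick_quot tM (X := Z) (f := 0) (g := f)) => //.
- split; first exact: zero_inB.
    by move=> j; apply: zero_iso.
  by move=> i j; rewrite comp0m.
- by move=> j; rewrite comp0m compm0.
- exact: Multi_ses_iso.
- exact: thick_zero.
Qed.

Definition shiftE (X : endob (Multi R n.+1)) : endob (Multi R n.+1) :=
  @EndOb (Multi R n.+1) (shift (bc X)) (fun j => shift_mor (bact X j)).

Definition negE (X : endob (Multi R n.+1)) : endob (Multi R n.+1) :=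
  @EndOb (Multi R n.+1) (neg (bc X)) (fun j => neg_mor (bact X j)).

Definition coneE (X : bcomplex (Multi R n)) (c : itw X) (a : nat -> bmor X X)
    (ca : forall j, compat c (a j)) : endob (Multi R n.+1) :=
  @EndOb (Multi R n.+1) (cone c) (fun j => cone_act (ca j)).

Definition targetE (X : bcomplex (Multi R n)) (c : itw X) (a : nat -> bmor X X)
    (ca : forall j, compat c (a j)) : endob (Multi R n.+1) :=
  @EndOb (Multi R n.+1) (target c) (fun j => target_act (ca j)).

Definition rowE (X : bcomplex (Multi R n)) (c : itw X) (a : nat -> bmor X X)
    (ca : forall j, compat c (a j)) k : endob (Multi R n.+1) :=
  @EndOb (Multi R n.+1) (two_term (it_map c k)) (fun j => two_mor (proj2 (ca j) k)).

Lemma bcomp_ext (X : bcomplex (Multi R n)) (f g f' g' : @hom (BC (Multi R n)) X X) :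
  (forall k, (f : bmor X X) k \oc (g : bmor X X) k =
             (f' : bmor X X) k \oc (g' : bmor X X) k) -> f \oc g = f' \oc g'.
Proof. by move=> e; apply: bmor_ext. Qed.

Lemma actC (X : endob (Multi R n.+1)) : admissible X -> forall i j k,
  bact X i k \oc bact X j k = bact X j k \oc bact X i k.
Proof. by case=> _ _ h i j k; have := congr1 (fun u : bmor (bc X) (bc X) => u k) (h i j). Qed.

Lemma admissible_shift X : admissible X -> admissible (shiftE X).
Proof.
move=> aX; have cX := actC aX; have [BX iX _] := aX; split.
- exact: inB_shift.
- move=> j; apply: bmor_iso => k; apply: pre_map_iso => {}k.
  exact: (iso_bmor (iX j)).
- by move=> i j; apply: bcomp_ext => k; apply: pre_mapC => {}k; apply: cX.
Qed.

Lemma admissible_neg X : admissible X -> admissible (negE X).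
Proof.
move=> aX; have cX := actC aX; have [BX iX _] := aX; split.
- exact: inB_neg.
- by move=> j; apply: bmor_iso => k; apply: (iso_bmor (iX j)).
- by move=> i j; apply: bcomp_ext => k; apply: cX.
Qed.

Lemma admissible_iter_shift i X : admissible X -> admissible (iter i shiftE X).
Proof. by move=> aX; elim: i => //= i; apply: admissible_shift. Qed.

(* X is not required to be acyclic: it may be a brutal truncation. *)
Record family (X : bcomplex (Multi R n)) (c : itw X) (a : nat -> bmor X X) : Prop := Family {
  fam_inB : forall k, inB (X k);
  fam_supp : finite_support X;
  fam_iso : forall k, is_iso (it_map c k);
  fam_act : forall j k, is_iso (a j k);
  fam_comm : forall i j k, a i k \oc a j k = a j k \oc a i k }.

Lemma family_drop X c a : family (X := X) c a -> family (drop_itw c) (fun j => drop_mor (a j)).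
Proof.
case=> h1 [N h2] h3 h4 h5; split=> [k||k|j k|i j k].
- exact: h1.
- by exists N => k Nk; apply/h2/leqW.
- exact: h3.
- exact: h4.
- exact: h5.
Qed.

Lemma admissible_cone X c a (ca : forall j, compat (X := X) c (a j)) :
  family c a -> admissible (coneE ca).
Proof.
case=> h1 h2 h3 h4 h5; split; first exact: inB_cone.
  by move=> j; apply: bmor_iso => k; apply: cone_act_iso.
by move=> i j; apply: bcomp_ext => k; apply: cone_actC => {}k; apply: h5.
Qed.

Lemma admissible_row X c a (ca : forall j, compat (X := X) c (a j)) k :
  family c a -> admissible (rowE ca k).
Proof.
case=> h1 h2 h3 h4 h5; split; first exact: two_term_inB.
  move=> j; apply: bmor_iso => -[|[|l]] //=.
  by apply: zero_iso; apply: zob0.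
by move=> i j; apply: bcomp_ext => -[|[|l]] //=; rewrite comp0m.
Qed.

Lemma ses_iter_shift (X Y Z : endob (Multi R n.+1)) (f : hom X Y) (g : hom Y Z) i :
  equivariant f -> equivariant g -> ses f g ->
  exists (f' : hom (iter i shiftE X) (iter i shiftE Y))
    (g' : hom (iter i shiftE Y) (iter i shiftE Z)),
    [/\ equivariant f', equivariant g' & ses f' g'].
Proof.
move=> ef eg sfg; elim: i => [|i [f' [g' [ef' eg' sfg']]]]; first by exists f, g.
exists (shift_mor (f' : bmor (bc (iter i shiftE X)) (bc (iter i shiftE Y)))).
exists (shift_mor (g' : bmor (bc (iter i shiftE Y)) (bc (iter i shiftE Z)))); split.
- move=> j; apply: bmor_ext => -[|k] /=; first by rewrite comp0m.
  by have := congr1 (fun u : bmor (bc (iter i shiftE X)) (bc (iter i shiftE Y)) => u k) (ef' j).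
- move=> j; apply: bmor_ext => -[|k] /=; first by rewrite comp0m.
  by have := congr1 (fun u : bmor (bc (iter i shiftE Y)) (bc (iter i shiftE Z)) => u k) (eg' j).
- case=> [|k] /=; last exact: sfg'.
  apply: Multi_ses_iso; first exact: zob0.
  by apply: zero_iso; apply: zob0.
Qed.

Lemma row_ses X (c : itw X) :
  ses (row_in c : @hom (Multi R n.+1) _ _) (row_out c : @hom (Multi R n.+1) _ _).
Proof.
by move=> k; have [r [s b]] := row_biproduct c k; apply: Multi_ses_split b.
Qed.

(* By induction on the length, splitting off the row X 0 -> X 0 of the cone. *)
Lemma thick_cone N X c a (ca : forall j, compat (X := X) c (a j)) :
  (forall k, (N <= k)%N -> is_zero (X k)) -> family (X := X) c a ->
  (forall i k, M (iter i shiftE (rowE ca k))) -> forall i, M (iter i shiftE (coneE ca)).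
Proof.
elim: N X c a ca => [|N IH] X c a ca zX fX Mrow i.
  apply: thick_zero; elim: i => [|i IHi].
    apply: bmor_ext => k; apply: bip_zero; first exact: zX.
    by case: k => [|k] /=; [apply: zob0 | apply: zX].
  apply: bmor_ext => -[|k] /=; first exact: zob0.
  by have := congr1 (fun u : bmor (bc (iter i shiftE (coneE ca))) (bc (iter i shiftE (coneE ca))) => u k) IHi.
have cd j : compat (drop_itw c) (drop_mor (a j)) := drop_compat (ca j).
have fd := family_drop fX.
have e1 : @equivariant (Multi R n.+1) (rowE ca 0) (coneE ca) (row_in c).
  by move=> j; apply: bmor_ext => k; apply: row_in_act.
have e2 : @equivariant (Multi R n.+1) (coneE ca) (shiftE (coneE cd)) (row_out c).
  by move=> j; apply: bmor_ext => k; rewrite /= row_out_act.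
have [f [g [ef eg sfg]]] := ses_iter_shift i e1 e2 (row_ses c).
apply: (thick_mid tM _ _ _ ef eg sfg) => //; try apply: admissible_iter_shift.
- exact: admissible_row.
- exact: admissible_cone.
- by apply: admissible_shift; apply: admissible_cone.
(* The quotient carries one more shift, which is why the claim is made for all iterated shifts. *)
rewrite -iterSr; apply: IH => // [k Nk|l k]; first exact: zX.
rewrite (_ : rowE cd k = rowE ca k.+1) //.
by congr EndOb; apply: funext => j; apply: bmor_ext.
Qed.

Lemma cone_ses X (c : itw X) :
  ses (cone_in c : @hom (Multi R n.+1) _ _) (cone_out c : @hom (Multi R n.+1) _ _).
Proof. by move=> k; apply/Multi_ses_split/bip_biproduct. Qed.

Lemma cone_in_equivariant X c a (ca : forall j, compat (X := X) c (a j)) :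
  @equivariant (Multi R n.+1) (targetE ca) (coneE ca) (cone_in c).
Proof. by move=> j; apply: bmor_ext => k; rewrite /= /cone_map bip_map1. Qed.

Lemma cone_out_equivariant X c a (ca : forall j, compat (X := X) c (a j)) :
  @equivariant (Multi R n.+1) (coneE ca)
    (shiftE (negE (EndOb (a : nat -> @hom (Multi R n.+1) X X))))
    (cone_out c).
Proof.
by move=> j; apply: bmor_ext => k; rewrite /= /cone_map bp2_map; case: k.
Qed.

Lemma id_compat (X : bcomplex (Multi R n)) (f : bmor X X) : compat (id_itw X) f.
Proof. by split=> [b k|k] /=; rewrite ?bmapP // comp1l comp1r. Qed.

Lemma admissible_family (X : endob (Multi R n.+1)) :
  admissible X -> family (id_itw (bc X)) (fun j => bact X j).
Proof.
move=> aX; have cX := actC aX; have [[cX' sX _] iX _] := aX; split=> // [k|j k].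
- exact: id_iso.
- exact: (iso_bmor (iX j)).
Qed.

Lemma target_idE (X : endob (Multi R n.+1)) :
  targetE (fun j => id_compat (bact X j)) = X.
Proof.
case: X => -[X d dd] a; congr EndOb; apply: funext => j.
by apply: bmor_ext.
Qed.

Lemma diagonal_shift (X : endob (Multi R n.+1)) :
  (forall k, bd (bc X) false k = bd (bc X) true k) ->
  forall i k, bd (bc (iter i shiftE X)) false k = bd (bc (iter i shiftE X)) true k.
Proof. by move=> e; elim=> // i IH [|k] /=. Qed.

(** The rows of this cone have both differentials equal to 1, so they and their shifts are
    diagonal. *)
Lemma thick_id_cone (X : endob (Multi R n.+1)) : admissible X ->
  M (coneE (fun j => id_compat (bact X j))).
Proof.
move=> aX; have fX := admissible_family aX; have [[cX' [N sX] _] _ _] := aX.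
apply: (thick_cone sX fX _ 0) => i k; apply: (thick_diag tM).
  exact/admissible_iter_shift/admissible_row.
by apply: outer_diagonal; apply: diagonal_shift => -[].
Qed.

Lemma admissible_shift_neg (X : endob (Multi R n.+1)) :
  admissible X -> admissible (shiftE (negE X)).
Proof. by move=> aX; apply/admissible_shift/admissible_neg. Qed.

(** The cone of the identity is an extension of [shiftE (negE X)] by [X] and satisfies [M]; two out
    of three then works in both directions. *)
Lemma thick_shift_neg (X : endob (Multi R n.+1)) :
  admissible X -> M (shiftE (negE X)) <-> M X.
Proof.
move=> aX; have aC := admissible_cone (fun j => id_compat (bact X j)) (admissible_family aX).
have e1 := @cone_in_equivariant _ _ _ (fun j => id_compat (bact X j)).
have e2 := @cone_out_equivariant _ _ _ (fun j => id_compat (bact X j)).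
have aT : admissible (targetE (fun j => id_compat (bact X j))) by rewrite target_idE.
split=> h; last first.
  apply: (thick_quot tM aT aC (admissible_shift_neg aX) e1 e2 (cone_ses _) _
    (thick_id_cone aX)).
  by rewrite target_idE.
have := thick_sub tM aT aC (admissible_shift_neg aX) e1 e2 (cone_ses _) (thick_id_cone aX) h.
by rewrite target_idE.
Qed.

Lemma thick_shift (X : endob (Multi R n.+1)) : admissible X -> M X -> M (shiftE X).
Proof.
move=> aX MX; pose f := shift_mor (neg_iso (bc X)).
apply: (@thick_iso (shiftE (negE X)) (shiftE X) f).
- exact: admissible_shift_neg.
- exact: admissible_shift.
- move=> j; apply: bmor_ext => -[|k] /=; first by rewrite comp0m.
  exact: alternC.
- by apply: bmor_iso => k; apply: pre_map_iso => {}k; apply: altern_iso.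
- exact/thick_shift_neg.
Qed.

(** This eliminates the outermost direction. The cone of (theta, id) satisfies [M] because its rows
    do, and its subobject (X, \tilde d, \tilde d) because it is diagonal; hence so does the
    quotient, a shift of [X] up to sign. *)
Lemma thick_twisted (X : endob (Multi R n.+1)) (th : forall k, hom (bc X k) (bc X k))
    (tha : forall j k, bact X j k \oc th k = th k \oc bact X j k) :
  admissible X -> (forall k, is_iso (th k)) ->
  (forall k, bd (bc X) true k \oc th k.+1 = th k \oc bd (bc X) false k) ->
  (forall k, M (@EndOb (Multi R n.+1) (two_term (th k)) (fun j => two_mor (tha j k)))) ->
  M X.
Proof.
move=> aX thI thd Mrow.
have thP b k : bd (bc X) true k \oc or_id th b k.+1 = or_id th b k \oc bd (bc X) b k.
  by case: b; rewrite /= ?comp1l ?comp1r.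
pose c := @Itw _ (bc X) (fun=> bd (bc X) true) (fun=> bdd (bc X) true) th thP.
have ca j : compat c (bact X j) by split=> [b k|k] //=; rewrite bmapP.
have fX : family c (fun j => bact X j).
  by case: (admissible_family aX) => h1 h2 h3 h4 h5; split.
have aC := admissible_cone ca fX.
have MC : M (coneE ca).
  have [N sX] := fam_supp fX; apply: (thick_cone sX fX _ 0) => i k.
  have aR := admissible_row ca k fX.
  elim: i => [|i IH] /=; last by apply: thick_shift => //; apply: admissible_iter_shift.
  rewrite (_ : rowE ca k =
    @EndOb (Multi R n.+1) (two_term (th k)) (fun j => two_mor (tha j k))) //.
  by congr EndOb; apply: funext => j; apply: bmor_ext.
(* Both differentials of the target are [\tilde d], so acyclicity of [\tilde d] serves twice. *)
have aT : admissible (targetE ca).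
  have [[cX sX acX] iX _] := aX; split; first by split=> // b; exact: (acX true).
    by move=> j; apply: bmor_iso => k; apply: (iso_bmor (iX j)).
  by move=> i j; apply: bcomp_ext => k; exact: (actC aX).
have MT : M (targetE ca) by apply: (thick_diag tM) => //; apply: outer_diagonal.
apply/thick_shift_neg => //.
exact: (thick_quot tM aT aC (admissible_shift_neg aX) (cone_in_equivariant ca)
  (cone_out_equivariant ca) (cone_ses c) MT MC).
Qed.

End ThickComplexes.

(** * Turning an automorphism into an outermost differential *)

Section Descent.
Variables (n : nat) (M : endob (Multi R n.+1) -> Prop).
Hypothesis tM : thick M.

Definition comm0 (Y : endob (Multi R n)) : Prop :=
  forall j, eact Y j.+1 \oc eact Y 0 = eact Y 0 \oc eact Y j.+1.

Definition two_termE (Y : endob (Multi R n)) (c : comm0 Y) : endob (Multi R n.+1) :=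
  @EndOb (Multi R n.+1) (two_term (eact Y 0)) (fun j => two_mor (c j)).

(* The first of the automorphisms of Y is used up as an outermost differential;
   the remaining ones act on the resulting two-term complex. *)
Definition descend (Y : endob (Multi R n)) : Prop := forall c : comm0 Y, M (two_termE c).

Lemma admissible_comm0 (Y : endob (Multi R n)) : admissible Y -> comm0 Y.
Proof. by case=> _ _ h j; apply: h. Qed.

Lemma descendE (Y : endob (Multi R n)) (c : comm0 Y) : descend Y <-> M (two_termE c).
Proof. by split=> [|h c']; [apply | rewrite (Prop_irrelevance c' c)]. Qed.

Lemma admissible_two_term (Y : endob (Multi R n)) (c : comm0 Y) :
  admissible Y -> admissible (two_termE c).
Proof.
case=> BY iY cY; split; first exact: two_term_inB.
  move=> j; apply: bmor_iso => -[|[|l]] //=.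
  by apply: zero_iso; apply: zob0.
by move=> i j; apply: bmor_ext => -[|[|l]] //=; rewrite comp0m.
Qed.

Lemma two_mor_equivariant (X Y : endob (Multi R n)) (cX : comm0 X) (cY : comm0 Y)
    (f : hom X Y) (ef : equivariant f) :
  @equivariant (Multi R n.+1) (two_termE cX) (two_termE cY) (two_mor (ef 0)).
Proof. by move=> j; apply: bmor_ext => -[|[|l]] /=; rewrite ?comp0m. Qed.

Lemma two_mor_ses (X Y Z : endob (Multi R n)) (f : hom X Y) (g : hom Y Z)
    (ef : equivariant f) (eg : equivariant g) : ses f g ->
  ses (two_mor (ef 0) : @hom (Multi R n.+1) _ _) (two_mor (eg 0) : @hom (Multi R n.+1) _ _).
Proof.
move=> sfg [|[|l]] //=; apply: Multi_ses_iso; first exact: zob0.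
by apply: zero_iso; apply: zob0.
Qed.

(** Needed for the zero terms in degrees at least 2 of a two-term complex. *)
Lemma diagonal_in_zero i m (X : Multi R m) : (i < m)%N -> is_zero X -> diagonal_in i X.
Proof.
elim: m X => [//|m IH] X im X0 /=.
have X0k k : is_zero ((X : bcomplex (Multi R m)) k).
  by have := congr1 (fun u : bmor (X : bcomplex (Multi R m)) X => u k) X0.
have [_ k|ne k] := eqVneq.
  by rewrite (zero_to (bd _ false k)) // (zero_to (bd _ true k)).
by apply: IH => //; rewrite ltn_neqAle ne -ltnS.
Qed.

(** Forming two-term complexes is exact, preserves admissibility and keeps a multicomplex diagonal
    in an inner direction. *)
Lemma thick_descend : thick descend.
Proof.
split=> [X Y Z f g aX aY aZ ef eg sfg|X Y Z f g aX aY aZ ef eg sfg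
    |X Y Z f g aX aY aZ ef eg sfg|X aX [i im di] c].
- have [cX cY cZ] := And3 (admissible_comm0 aX) (admissible_comm0 aY) (admissible_comm0 aZ).
  rewrite (descendE cX) (descendE cY) (descendE cZ).
  by apply: (thick_quot tM _ _ _ (two_mor_equivariant cX cY ef)
    (two_mor_equivariant cY cZ eg) (two_mor_ses ef eg sfg)); apply: admissible_two_term.
- have [cX cY cZ] := And3 (admissible_comm0 aX) (admissible_comm0 aY) (admissible_comm0 aZ).
  rewrite (descendE cX) (descendE cY) (descendE cZ).
  by apply: (thick_sub tM _ _ _ (two_mor_equivariant cX cY ef)
    (two_mor_equivariant cY cZ eg) (two_mor_ses ef eg sfg)); apply: admissible_two_term.
- have [cX cY cZ] := And3 (admissible_comm0 aX) (admissible_comm0 aY) (admissible_comm0 aZ).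
  rewrite (descendE cX) (descendE cY) (descendE cZ).
  by apply: (thick_mid tM _ _ _ (two_mor_equivariant cX cY ef)
    (two_mor_equivariant cY cZ eg) (two_mor_ses ef eg sfg)); apply: admissible_two_term.
apply: (thick_diag tM); first exact: admissible_two_term.
exists i; first exact: ltnW.
rewrite /= ltn_eqF // => -[|[|k]] //=.
by apply: diagonal_in_zero => //; apply: zob0.
Qed.

End Descent.

(** * Reduction to cubes *)

Section Cubes.

(* au_cube A n is the cube on A 0, ..., A (n - 1), acted upon by A n, A (n + 1), ... *)
Record auts := Auts {
  au_ob : Mod R;
  au : nat -> hom au_ob au_ob;
  au_proj : fg_projective au_ob;
  au_iso : forall i, is_iso (au i);
  au_comm : forall i j, au i \oc au j = au j \oc au i }.

Definition au_tuple (A : auts) n : AutCat (Mod R) n :=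
  @AutTuple (Mod R) n (au_ob A) (fun i => au A i) (fun i => au_iso A i)
    (fun i j => au_comm A i j).

Definition au_mor (A : auts) n j : hom (au_tuple A n) (au_tuple A n) :=
  @AutMor (Mod R) n (au_tuple A n) (au_tuple A n) (au A j) (fun i => au_comm A j i).

Definition au_cube (A : auts) n : endob (Multi R n) :=
  @EndOb (Multi R n) (cube R n (au_tuple A n)) (fun j => fmap (cube R n) (au_mor A n (j + n))).

Definition on_cubes n (M : endob (Multi R n) -> Prop) : Prop := forall A, M (au_cube A n).

(** The two-term complex of the cube on [A 0], ..., [A (n - 1)] with respect to [A n] is the next
    cube, and the remaining actions start at [A n.+1]. *)
Lemma on_cubes_descend n (M : endob (Multi R n.+1) -> Prop) :
  on_cubes M -> on_cubes (descend M).
Proof.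
move=> MA A c; have := MA A.
rewrite (_ : au_cube A n.+1 = two_termE c) //; congr EndOb.
apply: funext => j; apply: bmor_ext => -[|[|k]] //=; congr fmap; apply: autmor_ext => /=;
  by rewrite addnS.
Qed.

(** Induction over the directions, for all [M] at once. Without directions, [X] is a projective
    module with commuting automorphisms, hence a cube. Otherwise [thick_twisted] reduces to rows,
    where the induction hypothesis is used for [descend M]. *)
Lemma thick_on_twisted n (M : endob (Multi R n) -> Prop) :
  thick M -> on_cubes M -> forall X : endob (Multi R n), admissible X ->
  forall s : str (MultiS R n) X, (forall j, smor s s (eact X j)) -> M X.
Proof.
elim: n M => [|n IH] M tM MA X aX s sX.
  case: X {s sX} aX => X a [BX iX cX]; have := MA (Auts BX iX cX).
  by congr M; congr EndOb; apply: funext => j /=; rewrite addn0.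
have [[BX _ _] iX cX] := aX.
have tha j k : (eact X j : bmor (eob X : bcomplex _) _) k \oc tw s k =
    tw s k \oc (eact X j : bmor (eob X : bcomplex _) _) k by case: (sX j k).
apply: (@thick_twisted n M tM X (tw s) tha) => // [k|k|k].
- by exists (twV s k); split; [apply: twK | apply: twVK].
- exact: tw_d.
(* The conjugating automorphism is put in front as number 0, the one that [descend] makes into a
   differential, so that [two_termE cY] is the row. *)
pose Y := @EndOb (Multi R n) ((eob X : bcomplex (Multi R n)) k)
  (fun j => if j is j'.+1 then (eact X j' : bmor (eob X : bcomplex _) _) k else tw s k).
have cY : comm0 Y by move=> j; apply: tha.
suff : descend M Y.
  move=> /(_ cY); congr M; congr EndOb; apply: funext => j; apply: bmor_ext => -[|[|l]] //.
apply: (IH _ (thick_descend tM) (on_cubes_descend MA) Y _ (tw_str s k)).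
  split; first exact: BX.
    by case=> [|j] /=; [exists (twV s k); split; [apply: twK | apply: twVK]
                       | apply: (iso_bmor (iX j))].
  case=> [|i] [|j] //=; rewrite ?tha //; exact: (actC aX).
by case=> [|j] /=; [apply: tw_smor | case: (sX j k)].
Qed.

End Cubes.
End ThickPredicates.

(** * The image of phi *)

Section Image.
Variables (R : comPzRingType) (n : nat) (phi : abhom (KM R n) (K R n)).

Lemma abimage_add (x y : K R n) : abimage phi x -> abimage phi y -> abimage phi (abadd x y).
Proof. by case=> a <- [b <-]; exists (abadd a b); apply: abfunD. Qed.

Lemma abimage_opp (x : K R n) : abimage phi x -> abimage phi (abopp x).
Proof. by case=> a <-; exists (abopp a); apply: abhomN. Qed.

Lemma abimage0 : abimage phi (ab0 (K R n)).
Proof. by exists (ab0 _); apply: abhom0. Qed.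

Lemma abimage_addl (x y : K R n) :
  abimage phi x -> abimage phi (abadd x y) -> abimage phi y.
Proof.
move=> hx hxy; rewrite -[y]abadd0 -(abaddN x) -abaddA.
by apply: abimage_add => //; apply: abimage_opp.
Qed.

Lemma abimage_addr (x y : K R n) :
  abimage phi y -> abimage phi (abadd x y) -> abimage phi x.
Proof. by rewrite abaddC; apply: abimage_addl. Qed.

Definition in_image (X : endob (Multi R n)) : Prop :=
  forall BX : inB (eob X), abimage phi (Kclass BX).

Lemma in_imageE (X : endob (Multi R n)) (BX : inB (eob X)) :
  in_image X <-> abimage phi (Kclass BX).
Proof. by split=> [|h BX']; [apply | rewrite (Prop_irrelevance BX' BX)]. Qed.

Lemma Kclass_ses (X Y Z : Multi R n) (BX : inB X) (BY : inB Y) (BZ : inB Z)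
    (f : hom X Y) (g : hom Y Z) :
  ses f g -> Kclass BY = abadd (Kclass BX) (Kclass BZ).
Proof.
move=> fg; rewrite -[RHS]/(pres_add (pres_pi _ _) (pres_pi _ _)) -pres_pi_add.
apply/pres_piP/ab_rel.
exact: (@K_ses R n (exist _ X BX) (exist _ Y BY) (exist _ Z BZ) f g fg).
Qed.

Lemma Kclass_diagonal (X : Multi R n) (BX : inB X) : diagonal X -> Kclass BX = ab0 (K R n).
Proof. by move=> dX; apply/pres_piP/ab_rel; apply: K_diagonal. Qed.

(** In K the class of the middle term is the sum of the outer ones and diagonal classes vanish,
    while the image is a subgroup. *)
Lemma thick_in_image : thick in_image.
Proof.
split=> [X Y Z f g [BX _ _] [BY _ _] [BZ _ _] _ _ fg
    |X Y Z f g [BX _ _] [BY _ _] [BZ _ _] _ _ fg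
    |X Y Z f g [BX _ _] [BY _ _] [BZ _ _] _ _ fg|X [BX _ _] dX].
- rewrite (in_imageE BX) (in_imageE BY) (in_imageE BZ) (Kclass_ses BX BY BZ fg).
  exact: abimage_addl.
- rewrite (in_imageE BX) (in_imageE BY) (in_imageE BZ) (Kclass_ses BX BY BZ fg).
  by move=> h hZ; apply: abimage_addr h.
- rewrite (in_imageE BX) (in_imageE BY) (in_imageE BZ) (Kclass_ses BX BY BZ fg).
  exact: abimage_add.
by rewrite (in_imageE BX) Kclass_diagonal //; apply: abimage0.
Qed.

Hypothesis hphi : is_phi phi.

Lemma in_image_on_cubes : on_cubes in_image.
Proof.
move=> A; have PA : fg_projective (aut_ob (au_tuple A n)) by apply: au_proj.
by apply/(@in_imageE (au_cube A n) (cube_inB PA)); rewrite -hphi; exists (KMclass PA).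
Qed.

Lemma twisted_in_image (X : Multi R n) (BX : inB X) :
  str (MultiS R n) X -> abimage phi (Kclass BX).
Proof.
(* No automorphism has been set aside at the start, so the family of actions is filled with
   identities. *)
move=> s; pose E := @EndOb (Multi R n) X (fun=> idc X).
suff : in_image E by apply.
apply: (@thick_on_twisted R n _ thick_in_image in_image_on_cubes E _ s).
  by split=> // j; apply: id_iso.
by move=> j; apply: smor1.
Qed.

End Image.

Theorem corollary2p9 (R : comPzRingType) (r n : nat)
    (hr : (1 <= r)%N) (hn : (1 <= n)%N)
    (phi : abhom (KM R n) (K R n)) (hphi : is_phi phi)
    (lambda : abhom (K R n) (K R n)) (hlambda : is_lambda r lambda) :
  forall x : K R n, abimage phi x -> abimage phi (lambda x).
Proof.
move=> _ [y <-]; rewrite -[y]pres_reprK.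
(* Both maps are additive, so a formal combination representing [y] is reduced to its generators. *)
elim: (pres_repr y) => [[T PT]||t IH|s IHs t IHt].
- rewrite [phi _](hphi T PT); have [BY ->] := hlambda _ (cube_inB PT).
  apply: (twisted_in_image hphi BY).
  (* The conjugating automorphisms of the cube are carried through \Lambda^r_n. *)
  exact: (sob (sLambdaB R r n) (scube_str (scubes R n) T)).
- by rewrite (abhom0 phi) (abhom0 lambda); apply: abimage0.
- by rewrite pres_pi_opp (abhomN phi) (abhomN lambda); apply: abimage_opp.
- by rewrite pres_pi_add (abfunD phi) (abfunD lambda); apply: abimage_add.
Qed.
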